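(* Let $G=\mathbb{Z}_2$ act freely on a finitistic space $X$ of cohomology type $(a,b)$, where both $a$ and $b$ are even, and let $n$ be the integer such that the non-trivial cohomology groups of $X$ are in degrees $0,n,2n,3n$. Then for every $m>3n$ there is no $\mathbb{Z}_2$-equivariant map $\mathbb{S}^m\to X$, where the sphere $\mathbb{S}^m$ carries the antipodal action.
   Context: A paracompact Hausdorff space is called finitistic if every open covering has a finite-dimensional (open) refinement. $H^*$ denotes Čech cohomology. Let $a,b$ be integers. A finitistic space $X$ has cohomology type $(a,b)$ if, for some integer $n\ge 1$, its only non-trivial integral cohomology groups are $H^{in}(X;\mathbb{Z})\cong\mathbb{Z}$ for $i=0,1,2,3$, with generators $v_i\in H^{in}(X;\mathbb{Z})$ satisfying $v_1^2=a v_2$ and $v_1v_2=b v_3$ (cup products). Actions are continuous; an action of $G$ on $X$ is free if for every $x\in X$ the isotropy subgroup $G_x=\{g\in G : gx=x\}$ is trivial. An equivariant map between $G$-spaces $Y$ and $X$ is a continuous map $\phi:Y\to X$ with $g\phi(y)=\phi(gy)$ for all $g\in G$, $y\in Y$. *)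

(* Defs.v *)
From HB Require Import structures.
From mathcomp Require Import all_boot all_order all_algebra all_fingroup.
From mathcomp Require Import all_classical all_reals topology normedtype.
From mathcomp Require Import generic_quotient ring.

Set Implicit Arguments.
Unset Strict Implicit.
Unset Printing Implicit Defensive.

Import GRing.Theory numFieldNormedType.Exports.

Local Open Scope classical_set_scope.
Local Open Scope ring_scope.
Local Open Scope quotient_scope.

Section Coverings.
Variable X : topologicalType.
Implicit Types (U V W : set (set X)) (s : seq (set X)).

Definition open_cover U := U `<=` open /\ \bigcup_(A in U) A = setT.

Definition refines V U := forall A, V A -> exists2 B, U B & A `<=` B.

(* A finite list of members of U, possibly with repetitions, whose
   intersection is nonempty: an ordered simplex of the nerve of U. *)
Definition in_nerve U s :=
  (forall A, A \in s -> U A) /\ exists x : X, forall A, A \in s -> A x.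

Definition finite_dimensional U :=
  exists d : nat, forall s, uniq s -> in_nerve U s -> (size s <= d.+1)%N.

Definition locally_finite U := forall x : X,
  exists2 N, nbhs x N & finite_set [set A | U A /\ A `&` N !=set0].

Definition paracompact := forall U, open_cover U ->
  exists V, [/\ open_cover V, refines V U & locally_finite V].

Definition finitistic :=
  [/\ hausdorff_space X, paracompact &
      forall U, open_cover U ->
        exists V, [/\ open_cover V, refines V U & finite_dimensional V]].

End Coverings.

Section Cochains.
Variable X : topologicalType.
Implicit Types (U V W : set (set X)) (s t : seq (set X)) (p q : nat).

Definition simplex U p s := size s = p.+1 /\ in_nerve U s.

(* A p-cochain of the nerve of U is represented by any function on lists of
   sets; only its values on the p-simplices of the nerve are relevant. *)
Definition cochain := seq (set X) -> int.
Implicit Types (c e b : cochain).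

Definition del i s := take i s ++ drop i.+1 s.

Definition cobound c : cochain :=
  fun s => \sum_(i < size s) (-1) ^+ i * c (del i s).

Definition cocycle U p c := forall s, simplex U p.+1 s -> cobound c s = 0.

Definition coboundary U p c :=
  if p is p'.+1 then exists b, forall s, simplex U p s -> c s = cobound b s
  else forall s, simplex U p s -> c s = 0.

(* Front p-face times back face: the Alexander-Whitney formula. *)
Definition cup_cochain p c e : cochain :=
  fun s => c (take p.+1 s) * e (drop p s).

Definition projection V U (r : set X -> set X) :=
  forall A, V A -> U (r A) /\ A `<=` r A.

Definition pullback (r : set X -> set X) c : cochain := fun s => c (map r s).

Lemma pullback_comp (r r' : set X -> set X) c s :
  pullback (r' \o r) c s = pullback r (pullback r' c) s.
Proof. by rewrite /pullback -map_comp. Qed.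

Definition meet U V : set (set X) :=
  [set C | exists A B, [/\ U A, V B & C = A `&` B]].

Definition proj U (A : set X) : set X := xget setT [set B | U B /\ A `<=` B].

Lemma projP V U : refines V U -> projection V U (proj U).
Proof.
move=> h A VA; have [B UB AB] := h _ VA.
by rewrite /proj; case: xgetP => [C -> //|/(_ B)[]].
Qed.

Lemma projection_refines V U r : projection V U r -> refines V U.
Proof. by move=> h A /h[? ?]; exists (r A). Qed.

Lemma projection_id U : projection U U id.
Proof. by move=> A UA; split. Qed.

Lemma projection_comp W V U r r' :
  projection W V r -> projection V U r' -> projection W U (r' \o r).
Proof.
move=> h h' A /h[/h'[? s'] sr]; split => //; exact: (subset_trans sr).
Qed.

Lemma refines_trans V U W : refines W V -> refines V U -> refines W U.
Proof.
move=> h h' A /h[B /h'[C UC BC] AB]; exists C => //; exact: subset_trans AB BC.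
Qed.

Lemma refines_refl U : refines U U.
Proof. by move=> A ?; exists A. Qed.

Lemma meet_refinesl U V : refines (meet U V) U.
Proof. by move=> _ [A [B [? ? ->]]]; exists A => // x []. Qed.

Lemma meet_refinesr U V : refines (meet U V) V.
Proof. by move=> _ [A [B [? ? ->]]]; exists B => // x []. Qed.

Lemma meet_cover U V : open_cover U -> open_cover V -> open_cover (meet U V).
Proof.
move=> [oU cU] [oV cV]; split.
  by move=> _ [A [B [/oU ? /oV ? ->]]]; exact: openI.
rewrite -subTset => x _.
have [A UA Ax] : (\bigcup_(A in U) A) x by rewrite cU.
have [B VB Bx] : (\bigcup_(A in V) A) x by rewrite cV.
by exists (A `&` B) => //; exists A, B.
Qed.

Lemma coverT : open_cover [set @setT X].
Proof.
split; first by move=> _ ->; exact: openT.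
by rewrite bigcup_set1.
Qed.

Lemma in_nerve_sub U s t :
  {subset t <= s} -> in_nerve U s -> in_nerve U t.
Proof.
move=> ts [Us [x sx]]; split; first by move=> A /ts /Us.
by exists x => A /ts /sx.
Qed.

Lemma in_nerve_map V U r s :
  projection V U r -> in_nerve V s -> in_nerve U (map r s).
Proof.
move=> pr [Vs [x sx]]; split.
  by move=> _ /mapP[A /Vs/pr[? _] ->].
by exists x => _ /mapP[A As ->]; have [_] := pr _ (Vs _ As); apply; exact: sx.
Qed.

Lemma simplex_map V U r p s :
  projection V U r -> simplex V p s -> simplex U p (map r s).
Proof.
by move=> pr [ss ns]; split; rewrite ?size_map//; exact: in_nerve_map ns.
Qed.

Lemma size_del i s : (i < size s)%N -> size (del i s) = (size s).-1.
Proof.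
move=> lis; rewrite size_cat size_take size_drop lis.
by case: (size s) lis => // n lin; rewrite subSS subnKC.
Qed.

Lemma del_sub i s : {subset del i s <= s}.
Proof. by move=> A; rewrite mem_cat => /orP[/mem_take|/mem_drop]. Qed.

Lemma del_cons0 A s : del 0 (A :: s) = s.
Proof. by rewrite /del /= drop0. Qed.

Lemma del_consS i A s : del i.+1 (A :: s) = A :: del i s.
Proof. by []. Qed.

Lemma map_del (r : set X -> set X) i s : map r (del i s) = del i (map r s).
Proof. by rewrite map_cat map_take map_drop. Qed.

Lemma cobound_nil c : cobound c [::] = 0.
Proof. by rewrite /cobound big_ord0. Qed.

Lemma cobound_cons c A s :
  cobound c (A :: s) = c s - cobound (fun t => c (A :: t)) s.
Proof.
rewrite /cobound /= big_ord_recl /= mul1r del_cons0 -sumrN; congr (_ + _).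
by apply: eq_bigr => i _; rewrite /= exprS mulN1r mulNr.
Qed.

Lemma coboundD c e s :
  cobound (fun t => c t + e t) s = cobound c s + cobound e s.
Proof. by rewrite -big_split; apply: eq_bigr => i _; rewrite mulrDr. Qed.

Lemma coboundN c s : cobound (fun t => - c t) s = - cobound c s.
Proof. by rewrite -sumrN; apply: eq_bigr => i _; rewrite mulrN. Qed.

Lemma cobound_pullback r c s :
  cobound (pullback r c) s = cobound c (map r s).
Proof.
by rewrite /cobound size_map; apply: eq_bigr => i _; rewrite /pullback map_del.
Qed.

Lemma coboundZ k c s : cobound (fun t => k * c t) s = k * cobound c s.
Proof. by rewrite /cobound mulr_sumr; apply: eq_bigr => i _; rewrite mulrCA. Qed.

(* Uniform description: no cochains in degree -1. *)
Lemma coboundaryP U p c : coboundary U p c <->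
  exists b, (p = 0 -> b [::] = 0) /\
    forall s, simplex U p s -> c s = cobound b s.
Proof.
case: p => [|p] /=; last by split=> -[b]; [exists b|case; exists b].
split.
  move=> h; exists (fun _ => 0); split => // s /h ->.
  by rewrite /cobound big1 // => i _; rewrite mulr0.
move=> [b [b0 h]] s us; rewrite (h _ us).
by case: us; case: s => // A [|//] _ _; rewrite cobound_cons b0 // cobound_nil subr0.
Qed.

Lemma eq_coboundary U p c e :
  (forall s, simplex U p s -> c s = e s) -> coboundary U p c -> coboundary U p e.
Proof.
move=> ce /coboundaryP[b [b0 h]]; apply/coboundaryP; exists b; split => // s us.
by rewrite -ce // h.
Qed.

Lemma coboundary0 U p : coboundary U p (fun _ => 0).
Proof.
apply/coboundaryP; exists (fun=> 0); split => // s _.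
by rewrite /cobound big1 // => i _; rewrite mulr0.
Qed.

Lemma coboundaryD U p c e : coboundary U p c -> coboundary U p e ->
  coboundary U p (fun s => c s + e s).
Proof.
move=> /coboundaryP[b [b0 h]] /coboundaryP[b' [b0' h']]; apply/coboundaryP.
exists (fun s => b s + b' s); split=> [p0|s us]; first by rewrite b0 // b0'.
by rewrite h // h' // coboundD.
Qed.

Lemma coboundaryN U p c : coboundary U p c -> coboundary U p (fun s => - c s).
Proof.
move=> /coboundaryP[b [b0 h]]; apply/coboundaryP.
exists (fun s => - b s); split=> [p0|s us]; first by rewrite b0 // oppr0.
by rewrite h // coboundN.
Qed.

Lemma coboundary_pullback V U p r c :
  projection V U r -> coboundary U p c -> coboundary V p (pullback r c).
Proof.
move=> pr /coboundaryP[b [b0 h]]; apply/coboundaryP.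
exists (pullback r b); split=> [/b0 //|s vs].
by rewrite cobound_pullback -h //; exact: simplex_map vs.
Qed.

Lemma cocycle_pullback V U p r c :
  projection V U r -> cocycle U p c -> cocycle V p (pullback r c).
Proof.
by move=> pr h s vs; rewrite cobound_pullback h //; exact: simplex_map vs.
Qed.

Lemma cocycleD U p c e : cocycle U p c -> cocycle U p e ->
  cocycle U p (fun s => c s + e s).
Proof. by move=> hc he s us; rewrite coboundD hc // he // addr0. Qed.

Lemma cocycleN U p c : cocycle U p c -> cocycle U p (fun s => - c s).
Proof. by move=> hc s us; rewrite coboundN hc // oppr0. Qed.

Lemma cocycle0 U p : cocycle U p (fun _ => 0).
Proof. by move=> s _; rewrite /cobound big1 // => i _; rewrite mulr0. Qed.

(* Chain homotopy between two projections onto the same covering. *)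
Definition prism (f g : set X -> set X) c : cochain := fun s =>
  \sum_(i < size s) (-1) ^+ i * c (map f (take i.+1 s) ++ map g (drop i s)).

Lemma prism_cons f g c A s : prism f g c (A :: s) =
  c (f A :: g A :: map g s) - prism f g (fun t => c (f A :: t)) s.
Proof.
rewrite /prism /= big_ord_recl /= mul1r take0 -sumrN; congr (_ + _).
by apply: eq_bigr => i _; rewrite /= exprS mulN1r mulNr.
Qed.

Lemma prismB f g c e s :
  prism f g (fun t => c t - e t) s = prism f g c s - prism f g e s.
Proof.
by rewrite /prism -sumrB; apply: eq_bigr => i _; rewrite mulrBr.
Qed.

Lemma prismP f g c s : cobound (prism f g c) s + prism f g (cobound c) s =
  c (map g s) - c (map f s).
Proof.
elim: s c => [|A s IH] c.
  by rewrite cobound_nil /prism big_ord0 addr0 /= subrr.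
rewrite cobound_cons prism_cons.
have -> : (fun t => prism f g c (A :: t)) = (fun t =>
    pullback g (fun t => c (f A :: g A :: t)) t +
    - prism f g (fun t => c (f A :: t)) t).
  by apply/funext => t; rewrite prism_cons.
rewrite coboundD coboundN cobound_pullback.
have -> : (fun t => cobound c (f A :: t)) =
    (fun t => c t - cobound (fun t => c (f A :: t)) t).
  by apply/funext => t; rewrite cobound_cons.
rewrite prismB !cobound_cons.
have /= := IH (fun t => c (f A :: t)) => /(canRL (addrK _)) ->.
by rewrite -[in LHS]addrA /=; ring.
Qed.

Lemma prism_vanish W U r r' p c s : projection W U r -> projection W U r' ->
  cocycle U p c -> simplex W p s -> prism r r' (cobound c) s = 0.
Proof.
move=> pr pr' hc [ss [Ws [x sx]]]; apply: big1 => -[i lis] _ /=.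
rewrite hc ?mulr0 //; split.
  rewrite size_cat !size_map size_takel // size_drop addSn subnKC ?ss //.
  by rewrite -ss ltnW.
split=> [B|]; last exists x => B; rewrite mem_cat => /orP[] /mapP[A As ->].
- by have [] := pr _ (Ws _ (mem_take As)).
- by have [] := pr' _ (Ws _ (mem_drop As)).
- by have [_] := pr _ (Ws _ (mem_take As)); apply; exact: sx (mem_take As).
- by have [_] := pr' _ (Ws _ (mem_drop As)); apply; exact: sx (mem_drop As).
Qed.

Lemma projection_homotopy W U r r' p c :
  projection W U r -> projection W U r' -> cocycle U p c ->
  coboundary W p (fun s => pullback r c s - pullback r' c s).
Proof.
move=> pr pr' hc; apply/coboundaryP; exists (prism r' r c); split=> [_|s ws].
  by rewrite /prism big_ord0.
by rewrite /pullback -prismP (prism_vanish pr' pr hc ws) addr0.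
Qed.

Lemma cobound_cup p c e s : (p.+1 < size s)%N ->
  cobound (cup_cochain p c e) s =
  cobound c (take p.+2 s) * e (drop p.+1 s)
  + (-1) ^+ p * (c (take p.+1 s) * cobound e (drop p s)).
Proof.
elim: p c s => [|p IH] c [//|A s] /=; rewrite ltnS => ps.
  case: s ps => // B s _; rewrite expr0 mul1r drop0 cobound_cons.
  have -> : (fun t => cup_cochain 0 c e (A :: t)) = (fun t => c [:: A] * e (A :: t)).
    by apply/funext => t; rewrite /cup_cochain /= take0.
  rewrite coboundZ /cup_cochain drop0 /= !take0 !cobound_cons cobound_nil.
  by ring.
rewrite !cobound_cons.
have -> : (fun t => cup_cochain p.+1 c e (A :: t)) =
  cup_cochain p (fun t => c (A :: t)) e by [].
by rewrite IH // /cup_cochain exprS; ring.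
Qed.

Lemma simplex_take U p q s : simplex U (p + q) s -> simplex U p (take p.+1 s).
Proof.
move=> [ss ns]; split; last by apply: in_nerve_sub ns => A /mem_take.
by rewrite size_take ss; case: ltngtP => // h; rewrite ltnS ltnNge leq_addr in h.
Qed.

Lemma simplex_drop U p q s : simplex U (p + q) s -> simplex U q (drop p s).
Proof.
move=> [ss ns]; split; last by apply: in_nerve_sub ns => A /mem_drop.
by rewrite size_drop ss -addnS addKn.
Qed.

Lemma cocycle_cup U p q c e : cocycle U p c -> cocycle U q e ->
  cocycle U (p + q) (cup_cochain p c e).
Proof.
move=> hc he s us; rewrite cobound_cup; last first.
  by case: us => -> _; rewrite !ltnS leq_addr.
rewrite he; last by apply: simplex_drop; rewrite addnS.
by rewrite !mulr0 addr0 hc ?mul0r //; apply: (@simplex_take _ _ q); rewrite addSn.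
Qed.

Lemma coboundary_cupl U p q c e : coboundary U p c -> cocycle U q e ->
  coboundary U (p + q) (cup_cochain p c e).
Proof.
case: p => [|p] hc he.
  apply: (eq_coboundary _ (coboundary0 _ _)) => s us.
  by rewrite /cup_cochain hc ?mul0r //; exact: (@simplex_take _ 0 q).
case: hc => b hb; exists (cup_cochain p b e) => s us.
rewrite cobound_cup; last by case: us => -> _; rewrite !ltnS leq_addr.
rewrite he; last by apply: simplex_drop; rewrite addnS -addSn.
rewrite !mulr0 addr0 /cup_cochain hb //; exact: simplex_take us.
Qed.

Lemma coboundary_cupr U p q c e : cocycle U p c -> coboundary U q e ->
  coboundary U (p + q) (cup_cochain p c e).
Proof.
case: q => [|q] hc he.
  apply: (eq_coboundary _ (coboundary0 _ _)) => s us.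
  by rewrite /cup_cochain he ?mulr0 //; exact: simplex_drop us.
case: he => b hb; rewrite addnS; exists (cup_cochain p (fun s => (-1) ^+ p * c s) b).
move=> s us; rewrite cobound_cup; last by case: us => -> _; rewrite !ltnS leq_addr.
rewrite coboundZ hc ?mulr0 ?mul0r ?add0r; last first.
  by apply: (@simplex_take _ _ q); rewrite addSn.
rewrite /cup_cochain hb ?mulrA -?signr_addb; last first.
  by apply: simplex_drop; rewrite addnS.
by rewrite -signr_odd -signr_addb addbb mul1r.
Qed.

End Cochains.

Section Cech.
Variable X : topologicalType.
Implicit Types (p q : nat) (U V W T : set (set X)).

Record cech_cocycle p := CechCocycle {
  cov : set (set X);
  coch : cochain X;
  covP : open_cover cov;
  cochP : cocycle cov p coch }.

(* Equality in the direct limit: the pullbacks to some common refinement differ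
   by a coboundary. *)
Definition cohomologous p (z w : cech_cocycle p) :=
  exists W r r', [/\ open_cover W, projection W (cov z) r,
    projection W (cov w) r' &
    coboundary W p (fun s => pullback r (coch z) s - pullback r' (coch w) s)].

Lemma cohomologousP p (z w : cech_cocycle p) : cohomologous z w <->
  exists T0, [/\ open_cover T0, refines T0 (cov z), refines T0 (cov w) &
    forall T r r', refines T T0 ->
      projection T (cov z) r -> projection T (cov w) r' ->
      coboundary T p (fun s => pullback r (coch z) s - pullback r' (coch w) s)].
Proof.
split=> [[W [r [r' [oW pr pr' h]]]]|[T0 [o0 rz rw h]]]; last first.
  exists T0, (proj (cov z)), (proj (cov w)); split => //; try exact: projP.
  by apply: h; [exact: refines_refl|exact: projP|exact: projP].
exists W; split => //; [exact: projection_refines pr|exact: projection_refines pr'|].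
move=> T t t' /projP pT pt pt'.
have h1 := projection_homotopy pt (projection_comp pT pr) (@cochP _ z).
have h2 := projection_homotopy (projection_comp pT pr') pt' (@cochP _ w).
have h3 := coboundary_pullback pT h.
apply: eq_coboundary (coboundaryD (coboundaryD h1 h3) h2) => s _.
by rewrite (pullback_comp _ r) (pullback_comp _ r') /pullback; rewrite !addrA !subrK.
Qed.

Lemma cohomologous_refl p (z : cech_cocycle p) : cohomologous z z.
Proof.
exists (cov z), id, id; split; [exact: covP|exact: projection_id|exact: projection_id|].
by apply: eq_coboundary (coboundary0 _ _) => s _; rewrite subrr.
Qed.

Lemma cohomologous_sym p (z w : cech_cocycle p) :
  cohomologous z w -> cohomologous w z.
Proof.
move=> [W [r [r' [oW pr pr' h]]]]; exists W, r', r; split => //.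
by apply: eq_coboundary (coboundaryN h) => s _; rewrite opprB.
Qed.

Lemma cohomologous_trans p (z w v : cech_cocycle p) :
  cohomologous z w -> cohomologous w v -> cohomologous z v.
Proof.
move=> /cohomologousP[T [oT Tz Tw h]] /cohomologousP[T' [oT' T'w T'v h']].
pose rz := proj (cov z); pose rw := proj (cov w); pose rv := proj (cov v).
have ml := @meet_refinesl _ T T'; have mr := @meet_refinesr _ T T'.
have prz : projection (meet T T') (cov z) rz by exact/projP/(refines_trans ml).
have prw : projection (meet T T') (cov w) rw by exact/projP/(refines_trans ml).
have prv : projection (meet T T') (cov v) rv by exact/projP/(refines_trans mr).
exists (meet T T'), rz, rv; split => //; first exact: meet_cover.
apply: eq_coboundary (coboundaryD (h _ _ _ ml prz prw) (h' _ _ _ mr prw prv)).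
by move=> s _; rewrite addrA subrK.
Qed.

Section Groups.
Variable p : nat.

HB.instance Definition _ := gen_eqMixin (cech_cocycle p).
HB.instance Definition _ := gen_choiceMixin (cech_cocycle p).

Definition cohomologousb : rel (cech_cocycle p) :=
  fun z w => `[< cohomologous z w >].

Lemma cohomologousb_equiv : equiv_class_of cohomologousb.
Proof.
split=> [z|z w|w z v]; rewrite /cohomologousb.
- exact/asboolP/cohomologous_refl.
- by apply/asboolP/asboolP; exact: cohomologous_sym.
- move=> /asboolP h /asboolP h'; apply/asboolP; exact: cohomologous_trans h h'.
Qed.

Canonical cohomologous_equiv := EquivRelPack cohomologousb_equiv.

Definition cechH := {eq_quot cohomologous_equiv}.
HB.instance Definition _ := Choice.on cechH.
HB.instance Definition _ := EqQuotient.on cechH.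

Lemma cechP (z w : cech_cocycle p) :
  \pi_cechH z = \pi_cechH w <-> cohomologous z w.
Proof.
split=> [/eqmodP|h]; first by move/asboolP.
by apply/eqmodP/asboolP.
Qed.

Definition zero_cocycle : cech_cocycle p :=
  CechCocycle (coverT X) (@cocycle0 X _ p).

Definition opp_cocycle (z : cech_cocycle p) : cech_cocycle p :=
  CechCocycle (@covP _ z) (cocycleN (@cochP _ z)).

Definition add_cocycle (z w : cech_cocycle p) : cech_cocycle p :=
  CechCocycle (meet_cover (@covP _ z) (@covP _ w))
    (cocycleD
      (cocycle_pullback (projP (@meet_refinesl _ (cov z) (cov w))) (@cochP _ z))
      (cocycle_pullback (projP (@meet_refinesr _ (cov z) (cov w))) (@cochP _ w))).

Definition cech_zero : cechH := \pi_cechH zero_cocycle.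
Definition cech_opp (x : cechH) : cechH := \pi_cechH (opp_cocycle (repr x)).
Definition cech_add (x y : cechH) : cechH := \pi_cechH (add_cocycle (repr x) (repr y)).

Section OnCover.
Variables (W : set (set X)) (oW : open_cover W).

Lemma pi_reprP (z : cech_cocycle p) : cohomologous (repr (\pi_cechH z)) z.
Proof. by apply/cechP; rewrite reprK. Qed.

Lemma cech_eq0 c (hc : cocycle W p c) :
  (forall s, simplex W p s -> c s = 0) -> \pi_cechH (CechCocycle oW hc) = cech_zero.
Proof.
move=> c0; apply/cechP; exists W, id, (fun=> setT); split => //; first exact: projection_id.
by apply: eq_coboundary (coboundary0 _ _) => s us; rewrite /= /pullback map_id /= c0 // subr0.
Qed.

Lemma cech_oppE c (hc : cocycle W p c) :
  cech_opp (\pi_cechH (CechCocycle oW hc)) = \pi_cechH (CechCocycle oW (cocycleN hc)).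
Proof.
apply/cechP; have [T [r [r' [oT pr pr' h]]]] := pi_reprP (CechCocycle oW hc).
exists T, r, r'; split => //.
by apply: eq_coboundary (coboundaryN h) => s _; rewrite opprD.
Qed.

Lemma cech_addE c e (hc : cocycle W p c) (he : cocycle W p e) :
  cech_add (\pi_cechH (CechCocycle oW hc)) (\pi_cechH (CechCocycle oW he)) =
  \pi_cechH (CechCocycle oW (cocycleD hc he)).
Proof.
apply/cechP.
have /cohomologousP := pi_reprP (CechCocycle oW hc).
have /cohomologousP := pi_reprP (CechCocycle oW he).
set z := repr _; set w := repr _ => -[T [oT Tz TW h]] [T' [oT' T'w T'W h']].
have ml := @meet_refinesl _ T T'; have mr := @meet_refinesr _ T T'.
have m : refines (meet T T') (meet (cov w) (cov z)).
  move=> _ [A [B [/Tz[A' zA' AA'] /T'w[B' wB' BB'] ->]]].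
  by exists (B' `&` A'); [exists B', A'|move=> x [/AA' ? /BB' ?]].
have pm := projP m; have pW := projP (refines_trans ml TW).
exists (meet T T'), (proj (meet (cov w) (cov z))), (proj W).
split => //; first exact: meet_cover.
have hz := h _ _ _ ml
  (projection_comp pm (projP (@meet_refinesr _ (cov w) (cov z)))) pW.
have hw := h' _ _ _ mr
  (projection_comp pm (projP (@meet_refinesl _ (cov w) (cov z)))) pW.
apply: eq_coboundary (coboundaryD hw hz) => s _.
by rewrite !(pullback_comp (proj (meet (cov w) (cov z)))) /= addrACA opprD.
Qed.

End OnCover.

Lemma cech_restrict W (oW : open_cover W) (z : cech_cocycle p) r
    (pr : projection W (cov z) r) :
  \pi_cechH z = \pi_cechH (CechCocycle oW (cocycle_pullback pr (@cochP _ z))).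
Proof.
apply/cechP; exists W, r, id; split => //; first exact: projection_id.
by apply: eq_coboundary (coboundary0 _ _) => s _; rewrite /= [X in _ = _ - X]/pullback map_id subrr.
Qed.

Lemma cech_common (x y z : cechH) : exists W (oW : open_cover W) c e d
  (hc : cocycle W p c) (he : cocycle W p e) (hd : cocycle W p d),
  [/\ x = \pi_cechH (CechCocycle oW hc), y = \pi_cechH (CechCocycle oW he) &
      z = \pi_cechH (CechCocycle oW hd)].
Proof.
set U := cov (repr x); set V := cov (repr y); set T := cov (repr z).
have oW : open_cover (meet (meet U V) T).
  by do !apply: meet_cover; exact: covP.
have ml := @meet_refinesl _ (meet U V) T.
exists (meet (meet U V) T), oW, (pullback (proj U) (coch (repr x))),
  (pullback (proj V) (coch (repr y))), (pullback (proj T) (coch (repr z))).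
exists (cocycle_pullback
  (projP (refines_trans ml (@meet_refinesl _ U V))) (@cochP _ (repr x))).
exists (cocycle_pullback
  (projP (refines_trans ml (@meet_refinesr _ U V))) (@cochP _ (repr y))).
exists (cocycle_pullback
  (projP (@meet_refinesr _ (meet U V) T)) (@cochP _ (repr z))).
by split; rewrite -cech_restrict reprK.
Qed.

Lemma eq_cech W (oW : open_cover W) c e (hc : cocycle W p c)
    (he : cocycle W p e) : c =1 e ->
  \pi_cechH (CechCocycle oW hc) = \pi_cechH (CechCocycle oW he).
Proof.
move=> ce; apply/cechP; exists W, id, id; split => //; try exact: projection_id.
by apply: eq_coboundary (coboundary0 _ _) => s _; rewrite /= /pullback ce subrr.
Qed.

Lemma cech_addA : associative cech_add.
Proof.
move=> x y z; have [W [oW [c [e [d [hc [he [hd [-> -> ->]]]]]]]]] := cech_common x y z.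
by rewrite !cech_addE; apply: eq_cech => s; rewrite addrA.
Qed.

Lemma cech_addC : commutative cech_add.
Proof.
move=> x y; have [W [oW [c [e [d [hc [he [hd [-> -> _]]]]]]]]] := cech_common x y x.
by rewrite !cech_addE; apply: eq_cech => s; rewrite addrC.
Qed.

Lemma cech_add0 : left_id cech_zero cech_add.
Proof.
move=> x; have [W [oW [c [e [d [hc [_ [_ [-> _ _]]]]]]]]] := cech_common x x x.
rewrite -(@cech_eq0 W oW _ (@cocycle0 X W p)) // cech_addE.
by apply: eq_cech => s; rewrite add0r.
Qed.

Lemma cech_addN : left_inverse cech_zero cech_opp cech_add.
Proof.
move=> x; have [W [oW [c [e [d [hc [_ [_ [-> _ _]]]]]]]]] := cech_common x x x.
by rewrite cech_oppE cech_addE cech_eq0 // => s _; rewrite addNr.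
Qed.

HB.instance Definition _ := GRing.isZmodule.Build cechH
  cech_addA cech_addC cech_add0 cech_addN.

End Groups.

Definition cup_cocycle p q (z : cech_cocycle p) (w : cech_cocycle q) :
    cech_cocycle (p + q) :=
  CechCocycle (meet_cover (@covP _ z) (@covP _ w))
    (cocycle_cup
      (cocycle_pullback (projP (@meet_refinesl _ (cov z) (cov w))) (@cochP _ z))
      (cocycle_pullback (projP (@meet_refinesr _ (cov z) (cov w))) (@cochP _ w))).

Definition cup p q (x : cechH p) (y : cechH q) : cechH (p + q) :=
  \pi_(cechH (p + q)) (cup_cocycle (repr x) (repr y)).

Lemma cupE p q W (oW : open_cover W) c e (hc : cocycle W p c)
    (he : cocycle W q e) :
  cup (\pi_(cechH p) (CechCocycle oW hc)) (\pi_(cechH q) (CechCocycle oW he)) =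
  \pi_(cechH (p + q)) (CechCocycle oW (cocycle_cup hc he)).
Proof.
apply/cechP.
have /cohomologousP := pi_reprP (CechCocycle oW hc).
have /cohomologousP := pi_reprP (CechCocycle oW he).
set z := repr _; set w := repr _ => -[T [oT Tz TW h]] [T' [oT' T'w T'W h']].
have ml := @meet_refinesl _ T T'; have mr := @meet_refinesr _ T T'.
have m : refines (meet T T') (meet (cov w) (cov z)).
  move=> _ [A [B [/Tz[A' zA' AA'] /T'w[B' wB' BB'] ->]]].
  by exists (B' `&` A'); [exists B', A'|move=> x [/AA' ? /BB' ?]].
have pm := projP m; have pW := projP (refines_trans ml TW).
exists (meet T T'), (proj (meet (cov w) (cov z))), (proj W).
split => //; first exact: meet_cover.
have pz := projection_comp pm (projP (@meet_refinesr _ (cov w) (cov z))).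
have pw := projection_comp pm (projP (@meet_refinesl _ (cov w) (cov z))).
have hz := h _ _ _ ml pz pW.
have hw := h' _ _ _ mr pw pW.
have := coboundaryD (coboundary_cupl hw (cocycle_pullback pz (@cochP _ z)))
  (coboundary_cupr (cocycle_pullback pW hc) hz).
apply: eq_coboundary => s _.
rewrite /= /cup_cochain !(pullback_comp (proj (meet (cov w) (cov z)))) /pullback.
by rewrite ?map_take ?map_drop mulrBl mulrBr addrA subrK.
Qed.

End Cech.

Arguments cechH : clear implicits.

Section CohomologyType.
Variable X : topologicalType.

(* k |-> k v is an isomorphism from int onto H^p(X). *)
Definition infinite_cyclic_generator p (v : cechH X p) :=
  bijective (fun k : int => v *~ k).

(* The degrees 2n and 3n are written n + n and n + (n + n), which are
   the degrees of the cup products v1 v1 and v1 v2. *)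
Definition cohomology_type_in_degree (a b : int) (n : nat) :=
  [/\ finitistic X, (1 <= n)%N,
      forall p, p \notin [:: 0; n; n + n; n + (n + n)]%N ->
        forall x : cechH X p, x = 0 &
      exists (v0 : cechH X 0) (v1 : cechH X n) (v2 : cechH X (n + n))
             (v3 : cechH X (n + (n + n))),
        [/\ infinite_cyclic_generator v0, infinite_cyclic_generator v1,
            infinite_cyclic_generator v2 & infinite_cyclic_generator v3] /\
        (cup v1 v1 = v2 *~ a /\ cup v1 v2 = v3 *~ b)].

End CohomologyType.

Section Actions.
Variable gT : finGroupType.

(* gT is discrete, so joint continuity is continuity of each translation. *)
Definition continuous_action (X : topologicalType) (to : {action gT &-> X}) :=
  forall g : gT, continuous (fun x => to x g).

Definition isotropy (X : topologicalType) (to : {action gT &-> X}) (x : X) :=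
  [set g : gT | to x g = x].

Definition free_action (X : topologicalType) (to : {action gT &-> X}) :=
  forall x : X, isotropy to x = [set 1%g].

Definition equivariant_map (Y X : topologicalType) (toY : {action gT &-> Y})
    (toX : {action gT &-> X}) (phi : Y -> X) :=
  continuous phi /\ forall g y, toX (phi y) g = phi (toY y g).

End Actions.

Section Sphere.
Variables (R : realType) (m : nat).

(* The unit vectors for the Euclidean norm of R^(m+1). *)
Definition unit_sphere : set 'rV[R]_m.+1 :=
  [set y | \sum_i y ord0 i ^+ 2 = 1].

(* set_type carries the subspace topology. *)
Definition sphere : topologicalType := set_type unit_sphere.

Lemma antipodal_subproof (y : sphere) (g : 'Z_2) :
  (-1) ^+ g *: set_val y \in unit_sphere.
Proof.
rewrite inE /unit_sphere /= -[RHS](set_valP y).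
by apply: eq_bigr => i _; rewrite mxE exprMn sqrr_sign mul1r.
Qed.

Definition antipodal_fun (y : sphere) (g : 'Z_2) : sphere :=
  exist (fun v => v \in unit_sphere) _ (antipodal_subproof y g).

Lemma antipodal_fun1 : antipodal_fun^~ 1%g =1 id.
Proof. by move=> y; apply: val_inj; rewrite /= expr0 scale1r. Qed.

Lemma antipodal_funM y : act_morph antipodal_fun y.
Proof.
move=> g h; apply: val_inj; rewrite /= scalerA -exprD addnC.
by rewrite -signr_odd -[in RHS]signr_odd; congr (_ ^+ _ *: _); rewrite modn2 oddb.
Qed.

Definition antipodal : {action 'Z_2 &-> sphere} :=
  TotalAction antipodal_fun1 antipodal_funM.

End Sphere.

(* Main.v *)
Require Import Defs.
From mathcomp Require Import all_boot all_order all_algebra all_fingroup.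
From mathcomp Require Import all_classical all_reals topology.
From mathcomp Require Import normedtype zify ring lra.

(** The covering X -> X/T of the orbit space of a free involution T has a
    characteristic class w in the first mod 2 cohomology group of X/T, and an
    equivariant map from the sphere S^m would pull w back to the class of the
    double covering S^m -> RP^m.  The theorem follows by comparing powers of w:
    the power of exponent 3n + 1 vanishes on X/T, because the cohomology of X
    stops in degree 3n, whereas no power of exponent at most m vanishes on RP^m.

    Everything is done upstairs, with invariant cochains of the nerves of
    T-invariant coverings whose members A are disjoint from T A.  A sign eps on
    the members that distinguishes A from T A represents w by the cochain
    eps A + eps B, and the power w^k by wpow eps; mod 2 cochains are boolean
    functions on tuples.  The statement wpow_trivial k says that, on some such
    covering, w^k is the coboundary of an invariant cochain.

    - wpow_trivial_large: on a finite-dimensional nerve all high powers vanish.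
      The tuples that represent simplices may have repetitions, so cochains of
      high degree are not zero; but an equivariant homotopy deforms the identity
      of the cochain complex into a map whose values vanish on tuples with a
      repetition (reduce_htpP).
    - wpow_descent: if w^(k+1) = d c with c invariant, then
      z = c + eps w^k is a cocycle with z + T z = w^k.  Where H^k(X; F_2)
      vanishes, z = d y after a refinement, and w^k = d (y + T y) with y + T y
      invariant.  This is one step along the Smith exact sequence of X -> X/T.
      The mod 2 vanishing comes from the integral one in degrees k and k + 1
      (mod2_vanishing).
    - no_equivariant_map: there are mod 2 chains E_0, ..., E_m on S^m, made of
      arbitrarily small tuples of points, such that E_0 is one point and the
      boundary of E_(j+1) is E_j plus its antipode (hemisphere_chains); they
      subdivide the hemispheres of dimension j.  By induction on j, the value
      of w^j on E_j is 1.  If w^(k+1) pulled back from X were d c with c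
      invariant, its value on E_(k+1) would be the value of c + T c = 0 on E_k. *)

Set Implicit Arguments.
Unset Strict Implicit.
Unset Printing Implicit Defensive.

Import Order.TTheory GRing.Theory Num.Theory numFieldNormedType.Exports.

Local Open Scope classical_set_scope.

(** Proves identities between sums modulo 2 by cases on the summands. *)
Ltac addb_cases := repeat match goal with
  | |- context [addb ?x ?y] =>
      match x with true => fail 1 | false => fail 1 | addb _ _ => fail 1
      | _ => destruct x end
  | |- context [addb ?x ?y] =>
      match y with true => fail 1 | false => fail 1 | addb _ _ => fail 1
      | _ => destruct y end
  end; done.

(** * Mod 2 cochains on tuples *)

Section Coboundary.
Context {V : Type}.
Implicit Types (f g : seq V -> bool) (s : seq V) (eps : V -> bool).

Fixpoint delta f s : bool :=
  if s is a :: s' then f s' (+) delta (fun t => f (a :: t)) s' else false.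

Lemma deltaD f g s :
  delta (fun t => f t (+) g t) s = delta f s (+) delta g s.
Proof. by elim: s f g => //= a s IH f g; rewrite IH addbACA. Qed.

Lemma eq_delta f g s : f =1 g -> delta f s = delta g s.
Proof. by move=> /funext ->. Qed.

Lemma delta0 s : delta (fun=> false) s = false.
Proof. by elim: s => //= a s. Qed.

Lemma deltaZ k f s : delta (fun t => k && f t) s = k && delta f s.
Proof. by case: k => //; exact: delta0. Qed.

Lemma delta_delta f s : delta (delta f) s = false.
Proof.
elim: s f => //= a s IH f.
by rewrite deltaD IH addbF addbb.
Qed.

(** The k-fold cup power, on a tuple of size k + 1, of the 1-cocycle
    eps a + eps b: it is 1 exactly when the signs alternate along the tuple. *)
Fixpoint wpow eps s : bool :=
  if s is a :: s' then
    if s' is b :: _ then (eps a (+) eps b) && wpow eps s' else true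
  else true.

Lemma wpow_cons eps a b s :
  wpow eps (a :: b :: s) = (eps a (+) eps b) && wpow eps (b :: s).
Proof. by []. Qed.

Lemma delta_wpow eps a s : delta (fun t => wpow eps (a :: t)) s =
  if s is b :: t then wpow eps s else false.
Proof.
elim: s a => // b s IH a; rewrite [LHS]/=.
rewrite deltaZ IH; case: s {IH} => [|c s]; first by rewrite andbF.
rewrite (wpow_cons eps b); case: (wpow eps (c :: s));
by case: (eps a) (eps b) (eps c) => [] [] [].
Qed.

Lemma wpow_cocycle eps s : (1 < size s)%N -> delta (wpow eps) s = false.
Proof.
case: s => [|a [|b s]] // _.
by have /= -> := delta_wpow eps a (b :: s); rewrite addbb.
Qed.

(** w is the coboundary of the 0-cochain eps, which is not invariant; hence w^k
    is the coboundary of eps w^(k-1). *)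
Lemma wpow_delta eps s : (1 < size s)%N ->
  delta (fun t => if t is a :: _ then eps a && wpow eps t else false) s =
  wpow eps s.
Proof.
case: s => [|a [|b s]] // _.
have h : wpow eps (a :: s) (+) delta (fun t => wpow eps [:: a, b & t]) s =
    wpow eps (b :: s) := delta_wpow eps a (b :: s).
rewrite wpow_cons.
transitivity (eps b && wpow eps (b :: s) (+) (eps a && wpow eps (a :: s) (+)
  delta (fun t => eps a && wpow eps [:: a, b & t]) s)); first by [].
rewrite deltaZ -h; case: (wpow eps (a :: s)); case: (delta _ s).
all: by case: (eps a) (eps b) => [] [].
Qed.

End Coboundary.

Lemma wpow_flip (V : eqType) (eps eps' : V -> bool) s :
  (forall a, a \in s -> eps' a = ~~ eps a) -> wpow eps' s = wpow eps s.
Proof.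
elim: s => // a [//|b s] IH h.
rewrite !wpow_cons IH; last by move=> c cs; apply: h; rewrite inE cs orbT.
by rewrite !h ?inE ?eqxx ?orbT //; case: (eps a); case: (eps b).
Qed.

Lemma delta_map (V V' : Type) (r : V -> V') f s :
  delta (fun t => f (map r t)) s = delta f (map r s).
Proof. by elim: s f => //= a s IH f; rewrite (IH (fun t => f (r a :: t))). Qed.

Lemma wpow_map (V V' : Type) (r : V -> V') eps s :
  wpow eps (map r s) = wpow (fun a => eps (r a)) s.
Proof. by elim: s => // a [//|b s] /= ->. Qed.

Lemma eq_delta_in (V : eqType) (f g : seq V -> bool) s :
  (forall t, {subset t <= s} -> size s = (size t).+1 -> f t = g t) ->
  delta f s = delta g s.
Proof.
elim: s f g => //= a s IH f g h; congr (_ (+) _).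
  by apply: h => // x; rewrite inE orbC => ->.
apply: IH => t ts st; apply: h; rewrite /= ?st // => x; rewrite !inE.
by case/orP => [->//|/ts ->]; rewrite orbT.
Qed.

Section Prism.
Variables (V V' : eqType) (f g : V -> V').

(** The transpose of the prism operator, the chain homotopy between the maps
    induced by f and g. *)
Fixpoint mod2_prism (c : seq V' -> bool) (s : seq V) : bool :=
  if s is a :: s' then
    c (f a :: g a :: map g s') (+) mod2_prism (fun t => c (f a :: t)) s'
  else false.

Lemma mod2_prismD c e s :
  mod2_prism (fun t => c t (+) e t) s = mod2_prism c s (+) mod2_prism e s.
Proof. by elim: s c e => //= a s IH c e; rewrite IH addbACA. Qed.

Lemma mod2_prism0 s : mod2_prism (fun=> false) s = false.
Proof. by elim: s => //= a s ->. Qed.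

Lemma mod2_prismP c s :
  delta (mod2_prism c) s (+) mod2_prism (delta c) s = c (map g s) (+) c (map f s).
Proof.
elim: s c => [|a s IH] c /=; first by rewrite addbb.
rewrite deltaD (delta_map g (fun t => c (f a :: g a :: t))) mod2_prismD.
have := IH (fun t => c (f a :: t)) => /=.
by addb_cases.
Qed.

Lemma mod2_prism_delta c s : mod2_prism (delta c) s =
  c (map f s) (+) c (map g s) (+) delta (mod2_prism c) s.
Proof. by have := mod2_prismP c s; addb_cases. Qed.

Lemma eq_mod2_prism_in c e s :
  (forall u, {subset u <= map f s ++ map g s} -> size u = (size s).+1 ->
     c u = e u) -> mod2_prism c s = mod2_prism e s.
Proof.
elim: s c e => //= a s IH c e h; congr (_ (+) _).
  apply: h; last by rewrite /= size_map.
  by move=> x; rewrite !inE mem_cat !inE => /or3P[] -> //; rewrite ?orbT.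
apply: IH => u us su; apply: h => /=; last by rewrite su.
move=> x; rewrite !inE mem_cat inE => /orP[->//|/us].
by rewrite mem_cat => /orP[] ->; rewrite ?orbT.
Qed.

End Prism.

(** * Removing degenerate simplices *)

Section Carrier.
(** The method is that of acyclic carriers: every simplex is coned to a vertex
    m s of its own, which does not depend on the order of the vertices.  The chain map
    reduce sends a simplex without repetition to the cone with apex m s over
    the image of its boundary and kills the others; reduce_htp is the resulting
    homotopy from the identity to it.  Both are written as operators on
    cochains, so that t |-> f (m s :: t) is f evaluated on the cone. *)
Variables (V : eqType) (m : seq V -> V).
Hypothesis m_mem : forall s, s != [::] -> m s \in s.
Hypothesis m_perm : forall s s', perm_eq s s' -> m s = m s'.
Implicit Types (f g : seq V -> bool) (s t u : seq V).

(** The argument n is the size of s: it makes the recursion structural. *)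
Fixpoint reduce_rec n f s : bool :=
  if n is n'.+1 then
    uniq s && delta (reduce_rec n' (fun t => f (m s :: t))) s
  else f [::].
Definition reduce f s := reduce_rec (size s) f s.

Fixpoint reduce_htp_rec n f s : bool :=
  if n is n'.+1 then let g t := f (m s :: t) in
    g s (+) reduce g s (+) delta (reduce_htp_rec n' g) s
  else false.
Definition reduce_htp f s := reduce_htp_rec (size s) f s.

Lemma reduceE f s : s != [::] ->
  reduce f s = uniq s && delta (reduce (fun t => f (m s :: t))) s.
Proof.
case: s => // a s _; rewrite {1}/reduce [LHS]/=; congr (_ && _).
by apply: (@eq_delta_in _ _ _ (a :: s)) => t _ [st]; rewrite /reduce st.
Qed.

Lemma reduce_htpE f s : s != [::] -> let g t := f (m s :: t) in
  reduce_htp f s = g s (+) reduce g s (+) delta (reduce_htp g) s.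
Proof.
case: s => // a s _; cbv zeta; rewrite {1}/reduce_htp [LHS]/=; congr (_ (+) _).
by apply: (@eq_delta_in _ _ _ (a :: s)) => t _ [st]; rewrite /reduce_htp st.
Qed.

Lemma reduce_nuniq f s : ~~ uniq s -> reduce f s = false.
Proof. by move=> us; rewrite reduceE ?(negbTE us) //; apply: contraNneq us => ->. Qed.

Lemma size_ind (P : seq V -> Prop) :
  (forall s, (forall t, (size t < size s)%N -> P t) -> P s) -> forall s, P s.
Proof.
move=> h s; have [n] := ubnP (size s); elim: n s => // n IH s sn.
by apply: h => t ts; apply: IH; apply: leq_trans ts _.
Qed.

(** For a symmetric cochain the position of a deleted vertex does not matter,
    so the faces may be indexed by the vertices themselves. *)
Lemma delta_rem h s : (forall t t', perm_eq t t' -> h t = h t') ->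
  delta h s = \big[addb/false]_(x <- s) h (rem x s).
Proof.
elim: s h => [|a s IH] h hp /=; first by rewrite big_nil.
rewrite big_cons eqxx; congr (_ (+) _).
rewrite IH => [|t t' tt']; last by apply: hp; rewrite perm_cons.
apply: eq_big_seq => x xs; apply: hp; case: eqP => [->|_] //.
by rewrite perm_sym perm_to_rem.
Qed.

Lemma delta_perm h s s' : (forall t t', perm_eq t t' -> h t = h t') ->
  perm_eq s s' -> delta h s = delta h s'.
Proof.
move=> hp ss'; rewrite !delta_rem // (perm_big _ ss') /=.
apply: eq_bigr => x _; apply: hp; apply/seq.permP => p.
by rewrite !count_rem (seq.permP ss') (perm_mem ss').
Qed.

Lemma reduce_perm f s s' : perm_eq s s' -> reduce f s = reduce f s'.
Proof.
have [n] := ubnP (size s); elim: n f s s' => // n IH f s s' sn ss'.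
have [s0|s0] := eqVneq s [::].
  by move: ss'; rewrite s0 perm_sym => /perm_nilP ->.
have s0' : s' != [::] by apply: contraNneq s0 => e; move: ss'; rewrite e => /perm_nilP ->.
rewrite !reduceE // -(m_perm ss') (perm_uniq ss'); congr (_ && _).
set g := fun t => _.
pose h t := (size t < n)%N && reduce g t.
have hp t t' : perm_eq t t' -> h t = h t'.
  move=> tt'; rewrite /h -(perm_size tt'); case: ltnP => //= tn; exact: IH.
have e u : perm_eq u s -> delta (reduce g) u = delta h u.
  move=> us; apply: eq_delta_in => t _ st; rewrite /h.
  by move: sn; rewrite -(perm_size us) st ltnS => ->.
by rewrite e // e 1?perm_sym //; apply: delta_perm.
Qed.

Lemma reduceD f g s : reduce (fun t => f t (+) g t) s = reduce f s (+) reduce g s.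
Proof.
elim/size_ind: s f g => s IH f g; have [->|s0] := eqVneq s [::]; first by [].
rewrite !reduceE //; case: uniq => //=; rewrite -deltaD.
by apply: eq_delta_in => t _ st; rewrite IH ?st.
Qed.

(** On a tuple with a repeated vertex a, the left-hand side is 0; on the right
    all faces have a repetition, except possibly the two that omit one of two
    occurrences of a, and these agree up to order, so that they cancel. *)
Lemma reduce_delta f s : reduce (delta f) s = delta (reduce f) s.
Proof.
elim/size_ind: s f => s IH f; have [->|s0] := eqVneq s [::]; first by [].
rewrite reduceE //; have [us|nus] /= := boolP (uniq s).
  transitivity (delta (fun t =>
    reduce f t (+) delta (reduce (fun t => f (m s :: t))) t) s).
    by apply: eq_delta_in => t ts st; rewrite (reduceD f) IH ?st.
  by rewrite deltaD delta_delta addbF.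
have [a [u su]] : exists a u, perm_eq s (a :: a :: u).
  have /hasP[a as' /= sa] : has (fun a => 1 < count_mem a s)%N s.
    apply: contraR nus => /hasPn h; apply/count_mem_uniq => a.
    case: (boolP (a \in s)) => [as'|/count_memPn//].
    by apply/eqP; rewrite eqn_leq leqNgt h //= -has_count has_pred1.
  have sa' : a \in rem a s.
    rewrite -has_pred1 has_count.
    by rewrite count_rem as' /= eqxx subn1 -ltnS prednK // (ltn_trans _ sa).
  exists a, (rem a (rem a s)); rewrite (seq.permPl (perm_to_rem as')) perm_cons.
  exact: perm_to_rem.
rewrite (delta_perm (@reduce_perm f) su) /= addbA addbb /=.
rewrite (eq_delta (g := fun=> false)) ?delta0 // => t.
by apply: reduce_nuniq; rewrite /= inE eqxx.
Qed.

Lemma reduce_htpD f g s :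
  reduce_htp (fun t => f t (+) g t) s = reduce_htp f s (+) reduce_htp g s.
Proof.
elim/size_ind: s f g => s IH f g; have [->|s0] := eqVneq s [::]; first by [].
rewrite !reduce_htpE //= reduceD.
rewrite (@eq_delta_in _ _ (fun t => reduce_htp (fun t => f (m s :: t)) t (+)
   reduce_htp (fun t => g (m s :: t)) t)) => [|t _ st]; last by rewrite IH ?st.
by rewrite deltaD; addb_cases.
Qed.

Lemma reduce_htp0 s : reduce_htp (fun=> false) s = false.
Proof. by have := reduce_htpD (fun=> false) (fun=> false) s; rewrite /= addbb. Qed.

Lemma reduce_htpP f s :
  delta (reduce_htp f) s (+) reduce_htp (delta f) s = f s (+) reduce f s.
Proof.
elim/size_ind: s f => s IH f; have [->|s0] := eqVneq s [::].
  by rewrite /= addbb.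
rewrite (reduce_htpE (delta f)) //=.
set g := fun t => f (m s :: t).
rewrite (reduceD f) (reduce_delta g).
rewrite (@eq_delta_in _ (reduce_htp (fun t => f t (+) delta g t))
  (fun t => reduce_htp f t (+) (g t (+) reduce g t (+) delta (reduce_htp g) t))).
  by rewrite deltaD (deltaD (fun t => g t (+) _ t)) deltaD delta_delta; addb_cases.
move=> t ts st; rewrite (reduce_htpD f); congr (_ (+) _).
by have := IH t _ g; rewrite st => <- //; addb_cases.
Qed.

Lemma eq_reduce_in f g s :
  (forall u, {subset u <= s} -> size u = size s -> f u = g u) ->
  reduce f s = reduce g s.
Proof.
elim/size_ind: s f g => s IH f g h; have [s0|s0] := eqVneq s [::].
  by rewrite s0; apply: h; rewrite s0.
rewrite !reduceE //; congr (_ && _); apply: eq_delta_in => t ts st.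
apply: IH => [|u ut su]; first by rewrite st.
apply: h => [x|/=]; last by rewrite su.
by rewrite inE => /orP[/eqP ->|/ut/ts//]; exact: m_mem.
Qed.

Lemma eq_reduce_htp_in f g s :
  (forall u, {subset u <= s} -> size u = (size s).+1 -> f u = g u) ->
  reduce_htp f s = reduce_htp g s.
Proof.
elim/size_ind: s f g => s IH f g h; have [->//|s0] := eqVneq s [::].
have hc u : {subset u <= s} -> size u = size s -> f (m s :: u) = g (m s :: u).
  move=> us su; apply: h => [x|/=]; last by rewrite su.
  by rewrite inE => /orP[/eqP ->|/us//]; exact: m_mem.
rewrite !reduce_htpE // hc // (eq_reduce_in hc); congr (_ (+) _).
apply: eq_delta_in => t ts st.
apply: IH => [|u ut su]; first by rewrite st.
by apply: hc => [x /ut/ts//|]; rewrite su st.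
Qed.

Variable r : V -> V.
Hypothesis r_inj : injective r.

Lemma reduce_map f s :
  (forall t, t != [::] -> {subset t <= s} -> m (map r t) = r (m t)) ->
  reduce f (map r s) = reduce (fun t => f (map r t)) s.
Proof.
elim/size_ind: s f => s IH f h; have [->//|s0] := eqVneq s [::].
rewrite !reduceE // -?size_eq0 ?size_map ?size_eq0 // map_inj_uniq // -delta_map h //.
congr (_ && _); apply: eq_delta_in => t ts st.
by rewrite IH ?st // => u u0 ut; apply: h => // x /ut/ts.
Qed.

Lemma reduce_htp_map f s :
  (forall t, t != [::] -> {subset t <= s} -> m (map r t) = r (m t)) ->
  reduce_htp f (map r s) = reduce_htp (fun t => f (map r t)) s.
Proof.
elim/size_ind: s f => s IH f h; have [->//|s0] := eqVneq s [::].
rewrite !reduce_htpE // -?size_eq0 ?size_map ?size_eq0 // -delta_map reduce_map // h //.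
congr (_ (+) _); apply: eq_delta_in => t ts st.
by rewrite IH ?st // => u u0 ut; apply: h => // x /ut/ts.
Qed.

End Carrier.

(** * Involutions on sets *)

Local Open Scope ring_scope.

Section Involutions.
Variables (V : choiceType) (t : V -> V).
Hypothesis tt : involutive t.

(** Choosing an element of the set {v, t v} gives the same result for v and
    t v. *)
Lemma orbit_representative : exists rho : V -> V, forall v,
  rho (t v) = rho v /\ (rho v = v \/ rho v = t v).
Proof.
exists (fun v => xget v [set u | u = v \/ u = t v]) => v; split.
  have -> : [set u | u = t v \/ u = t (t v)] = [set u | u = v \/ u = t v].
    by apply/seteqP; split => u /=; rewrite tt; tauto.
  rewrite /xget; case: pselect => // -[]; exists v; apply/asboolP; by left.
by case: xgetP => [u _ //|/(_ v) []]; left.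
Qed.

Lemma odd_sign_exists : exists eps : V -> bool,
  forall v, t v <> v -> eps (t v) = ~~ eps v.
Proof.
have [rho h] := orbit_representative; exists (fun v => `[< rho v = v >]) => v tv.
have [-> [->|->]] := h v; by rewrite (asboolT (erefl _)) asboolF // => /esym.
Qed.

(** Choose freely on one point of each orbit and transport the choice to the
    other point. *)
Lemma equivariant_choice (V' : Type) (w0 : V') (t' : V' -> V') (S : set V)
    (P : V -> V' -> Prop) : involutive t' ->
  (forall v w, S v -> P v w -> P (t v) (t' w)) ->
  (forall v, S v -> S (t v)) ->
  (forall v, S v -> exists w, P v w) ->
  exists r : V -> V', forall v, S v ->
    P v (r v) /\ (t v <> v -> r (t v) = t' (r v)).
Proof.
move=> tt' Pt St h; have [eps heps] := odd_sign_exists.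
have [r0 hr0] : {r0 : V -> V' & forall v, S v -> P v (r0 v)}.
  apply: (@choice _ _ (fun v w => S v -> P v w)) => v; have [Sv|nSv] := pselect (S v).
    by have [w ?] := h _ Sv; exists w.
  by exists w0.
exists (fun v => if eps v then r0 v else t' (r0 (t v))) => v Sv; split.
  case: (eps v); first exact: hr0.
  by rewrite -{1}(tt v); apply: (Pt _ _ (St _ Sv)); apply/hr0/St.
by move=> /heps ->; rewrite tt; case: (eps v).
Qed.

End Involutions.

(** * Vanishing of mod 2 cohomology *)

Section IntegralToMod2.
Variable X : topologicalType.
Implicit Types (W T U V : set (set X)) (s : seq (set X)).

Definition parity (z : int) := odd `|z|%N.

Lemma parity_cobound (c : cochain X) s :
  parity (cobound c s) = delta (fun t => parity (c t)) s.
Proof.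
elim: s c => [|A s IH] c; first by rewrite cobound_nil.
by rewrite cobound_cons /= -IH /parity; lia.
Qed.

Lemma cobound_cobound (c : cochain X) s : cobound (cobound c) s = 0.
Proof.
elim: s c => [|A s IH] c; first by rewrite cobound_nil.
rewrite cobound_cons.
have -> : (fun t => cobound c (A :: t)) =
    (fun t => c t + - cobound (fun u => c (A :: u)) t).
  by apply/funext => t; rewrite cobound_cons.
by rewrite coboundD coboundN IH oppr0 addr0 subrr.
Qed.

Lemma eq_cobound U p (c e : cochain X) s : simplex U p.+1 s ->
  (forall t, simplex U p t -> c t = e t) -> cobound c s = cobound e s.
Proof.
move=> us h; apply: eq_bigr => i _; rewrite h //; case: us => ss ns; split.
  by rewrite size_del // ss.
exact: in_nerve_sub (@del_sub _ _ _) ns.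
Qed.

(** A class in a direct limit is zero when it becomes zero on some covering,
    and then on all finer ones, whatever the projections. *)
Lemma integral_vanishing p W (c : cochain X) :
  (forall x : cechH X p, x = 0) -> open_cover W -> cocycle W p c ->
  exists T0, [/\ open_cover T0, refines T0 W & forall T r, refines T T0 ->
    projection T W r -> coboundary T p (pullback r c)].
Proof.
move=> h oW hc.
have : cohomologous (CechCocycle oW hc) (zero_cocycle X p).
  by apply/cechP; rewrite (h (\pi_(cechH X p)%qT _)).
move=> /cohomologousP[T0 [o0 rW _ hT]]; exists T0; split => // T r rT pr.
have pT : projection T [set setT] (fun=> setT) by [].
by apply: eq_coboundary (hT T r (fun=> setT) rT pr pT) => s _; rewrite /= subr0.
Qed.

(** The Bockstein argument: lift c to an integral cochain c1.  Its coboundary is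
    2 e for a cocycle e of degree p + 2, which is d b on a refinement; then
    c1 - 2 b is a cocycle of degree p + 1, so it is a coboundary on a further
    refinement.  The projection that this produces is exchanged for an arbitrary
    one by the prism homotopy. *)
Lemma mod2_vanishing p W (c : seq (set X) -> bool) :
  (forall x : cechH X p.+1, x = 0) -> (forall x : cechH X p.+2, x = 0) ->
  open_cover W -> (forall s, simplex W p.+2 s -> delta c s = false) ->
  exists T0, [/\ open_cover T0, refines T0 W & forall T r, refines T T0 ->
    projection T W r ->
    exists y, forall s, simplex T p.+1 s -> c (map r s) = delta y s].
Proof.
move=> h1 h2 oW hc.
pose c1 : cochain X := fun s => (c s : nat)%:Z.
pose e : cochain X := fun s => (cobound c1 s %/ 2)%Z.
have par1 s : parity (c1 s) = c s by rewrite /c1 /parity; case: (c s).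
have he s : simplex W p.+2 s -> cobound c1 s = 2 * e s.
  move=> /hc; rewrite -[delta _ _](_ : parity (cobound c1 s) = _).
    by rewrite /e /parity; lia.
  by rewrite parity_cobound; apply: eq_delta.
have ce : cocycle W p.+2 e.
  move=> s ws; have : cobound (fun t => 2 * e t) s = 0.
    by rewrite -[RHS](cobound_cobound c1 s); apply/esym/(eq_cobound ws).
  by rewrite coboundZ; lia.
have [T0 [o0 r0 hT0]] := integral_vanishing h2 oW ce.
have pr0 := projP r0; have [b hb] := hT0 T0 (Defs.proj W) (@refines_refl _ _) pr0.
pose c2 : cochain X := fun s => pullback (Defs.proj W) c1 s + - (2 * b s).
have hc2 : cocycle T0 p.+1 c2.
  move=> s ts; rewrite coboundD coboundN coboundZ cobound_pullback -hb //.
  by rewrite he ?subrr //; apply: simplex_map ts.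
have [T1 [o1 r1 hT1]] := integral_vanishing h1 o0 hc2.
exists T1; split => //; first exact: refines_trans r1 r0.
move=> T r rT pr; have rT0 := refines_trans rT r1.
have pq := projP rT0; have [b2 hb2] := hT1 T (Defs.proj T0) rT pq.
pose f := Defs.proj W \o Defs.proj T0.
have pf : projection T W f := projection_comp pq pr0.
exists (fun s => parity (b2 s) (+) mod2_prism f r c s) => s ts.
rewrite deltaD -(parity_cobound b2) -hb2 //.
have -> : parity (pullback (Defs.proj T0) c2 s) = c (map f s).
  rewrite -par1 /c2 /pullback /f map_comp /parity; lia.
have := mod2_prismP f r c s.
rewrite [mod2_prism _ _ _ _](_ : _ = false).
  by rewrite addbF => ->; rewrite addbC addbK.
rewrite (@eq_mod2_prism_in _ _ f r (delta c) (fun=> false)).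
  exact: mod2_prism0.
move=> u us su; apply: hc; case: ts => ss [Ts [x sx]]; split; first by rewrite su ss.
split=> [A /us|]; last exists x => A /us; rewrite mem_cat => /orP[] /mapP[B Bs ->].
- by have [] := pf _ (Ts _ Bs).
- by have [] := pr _ (Ts _ Bs).
- by have [_] := pf _ (Ts _ Bs); apply; exact: sx.
- by have [_] := pr _ (Ts _ Bs); apply; exact: sx.
Qed.

End IntegralToMod2.

(** * Powers of the characteristic class of a free involution *)

Section FreeInvolution.
Variables (X : topologicalType) (T : X -> X).
Hypothesis Tc : continuous T.
Hypothesis TT : involutive T.
Implicit Types (W U V : set (set X)) (A B : set X) (s : seq (set X)).

(** Since T is an involution this is also the image of A under T. *)
Definition flip A : set X := T @^-1` A.

Lemma flipK : involutive flip.
Proof. by move=> A; apply/funext => x; rewrite /flip /preimage /= TT. Qed.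

Lemma flip_inj : injective flip. Proof. exact: inv_inj flipK. Qed.

Lemma open_flip A : open A -> open (flip A).
Proof. by move: A; apply/continuousP. Qed.

Definition free_cover W :=
  [/\ open_cover W, forall A, W A -> W (flip A) &
      forall A x, W A -> A x -> ~ A (T x)].

(** The common refinement of W and its image under the involution is invariant
    as a family of sets. *)
Definition symmetrize W : set (set X) := meet W (flip @` W).

Lemma symmetrize_cover W : open_cover W -> open_cover (symmetrize W).
Proof.
move=> oW; have [o c] := oW; apply: meet_cover => //; split.
  by move=> _ [A WA <-]; apply: open_flip; exact: o.
rewrite -subTset => x _.
have [A WA Ax] : (\bigcup_(A in W) A) (T x) by rewrite c.
by exists (flip A) => //; exists A.
Qed.

Lemma symmetrize_flip W A : symmetrize W A -> symmetrize W (flip A).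
Proof.
move=> [B [_ [WB [C WC <-] ->]]]; exists C, (flip B); split => //.
by rewrite setIC -[in RHS](flipK C).
Qed.

Lemma symmetrize_free_cover W U : open_cover W -> refines W U ->
  (forall A x, U A -> A x -> ~ A (T x)) -> free_cover (symmetrize W).
Proof.
move=> oW WU fU; split; first exact: symmetrize_cover.
  exact: symmetrize_flip.
move=> A x [B [_ [/WU[C UC BC] _ ->]]] [/BC Cx _] [/BC CTx _].
exact: fU UC Cx CTx.
Qed.

Lemma in_nerve_flip W s : (forall A, W A -> W (flip A)) ->
  in_nerve W s -> in_nerve W (map flip s).
Proof.
move=> fW [Ws [x sx]]; split=> [_ /mapP[A As ->]|]; first exact/fW/Ws.
by exists (T x) => _ /mapP[A As ->]; rewrite /flip /= TT; exact: sx.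
Qed.

Definition odd_sign W (eps : set X -> bool) :=
  forall A, W A -> A !=set0 -> eps (flip A) = ~~ eps A.

Lemma flip_neq W A : free_cover W -> W A -> A !=set0 -> flip A <> A.
Proof.
by move=> [_ _ fW] WA [x Ax] fA; apply: (fW _ _ WA Ax); rewrite -fA /flip /= TT.
Qed.

(** w^k is the coboundary of an invariant cochain on some free covering: in
    other words, w^k = 0 in the cohomology of the orbit space. *)
Definition wpow_trivial k := exists W eps c,
  [/\ free_cover W, odd_sign W eps,
      forall s, in_nerve W s -> c (map flip s) = c s &
      forall s, simplex W k s -> delta c s = wpow eps s].

Lemma wpow_flip_nerve W eps s : odd_sign W eps -> in_nerve W s ->
  wpow eps (map flip s) = wpow eps s.
Proof.
move=> he [Ws [x sx]]; rewrite wpow_map; apply: wpow_flip => A As.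
by apply: he; [exact: Ws|exists x; exact: sx].
Qed.

(** The cochain z below is c + eps w^(p+1); since eps changes under the
    involution, z plus its translate is w^(p+1).  After z = d y on a refinement
    V, the sum of y and its translate is the cochain sought; the projection
    r from V to W must be equivariant for this, and the sign on V is the
    composite of eps with r. *)
Lemma wpow_descent p :
  (forall x : cechH X p.+1, x = 0%R) -> (forall x : cechH X p.+2, x = 0%R) ->
  wpow_trivial p.+2 -> wpow_trivial p.+1.
Proof.
move=> h1 h2 [W [eps [c [fW he hc hdc]]]]; have [oW tW frW] := fW.
pose ew s := if s is A :: _ then eps A && wpow eps s else false.
pose z s := c s (+) ew s.
have dz s : simplex W p.+2 s -> delta z s = false.
  move=> ws; rewrite deltaD hdc // wpow_delta ?addbb //.
  by case: ws => ->.
have zflip s : s != [::] -> in_nerve W s ->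
    z (map flip s) = z s (+) wpow eps s.
  move=> s0 ws; rewrite /z hc // -addbA; congr (_ (+) _).
  have := wpow_flip_nerve he ws.
  case: s s0 ws => // A s _ [Ws [x sx]]; rewrite /ew /= => ->.
  rewrite he; [|by apply: Ws; rewrite inE eqxx|by exists x; apply: sx; rewrite inE eqxx].
  by case: (eps A); rewrite /= ?addbb ?addFb.
have [T0 [o0 r0 hT0]] := mod2_vanishing h1 h2 oW dz.
pose V := symmetrize T0.
have fV : free_cover V by apply: symmetrize_free_cover r0 _.
have [oV tV frV] := fV.
have rV : refines V T0 := @meet_refinesl _ _ _.
have [r hr] : exists r : set X -> set X, forall A, V A ->
    (W (r A) /\ A `<=` r A) /\ (flip A <> A -> r (flip A) = flip (r A)).
  apply: (@equivariant_choice _ flip flipK _ setT flip V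
    (fun A B => W B /\ A `<=` B)) => //.
  - exact: flipK.
  - by move=> A B VA [WB AB]; split; [exact: tW|move=> x /AB].
  - by move=> A /(refines_trans rV r0)[B WB AB]; exists B.
have pr : projection V W r by move=> A /hr[].
have [y hy] := hT0 V r rV pr.
have rflip s : in_nerve V s -> map r (map flip s) = map flip (map r s).
  move=> [Vs [x sx]]; rewrite -!map_comp; apply/eq_in_map => A As /=.
  have [_] := hr _ (Vs _ As); apply; apply: flip_neq fV (Vs _ As) _.
  by exists x; exact: sx.
exists V, (eps \o r), (fun s => y s (+) y (map flip s)); split => //.
- move=> A VA A0; have [_ e] := hr _ VA.
  rewrite /= e; last exact: flip_neq fV VA A0.
  have [WrA ArA] := pr _ VA; apply: he => //.
  by case: A0 => x Ax; exists x; exact: ArA.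
- move=> s _; rewrite addbC; congr (y _ (+) _).
  by rewrite -map_comp -[RHS]map_id; apply: eq_map => A; exact: flipK.
move=> s [ss ns]; rewrite deltaD delta_map -!hy //; last first.
  by split; [rewrite size_map|exact: in_nerve_flip].
rewrite rflip // zflip; first by rewrite addKb wpow_map.
  by case: s ss {ns}.
exact: in_nerve_map ns.
Qed.

Hypothesis Tfree : forall x, T x <> x.

Lemma free_open_cover : hausdorff_space X ->
  open_cover [set A | open A /\ forall x, A x -> ~ A (T x)].
Proof.
rewrite open_hausdorff => hX; split; first by move=> A [].
rewrite -subTset => x _.
have /hX[[A B] /= [Ax BTx] [oA oB /eqP/seteqP[AB _]]] : x != T x.
  by apply/eqP => /esym/Tfree.
exists (A `&` flip B); last by split; rewrite ?inE //; rewrite !inE in Ax BTx.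
split=> [|y [Ay By] [ATy _]]; first exact: openI oA (open_flip oB).
by have [] := AB (T y).
Qed.

(** At most d + 1 members of V contain x and at most d + 1 contain T x, so at
    most (d + 1)^2 sets of the form A `&` flip B contain x. *)
Lemma finite_dimensional_symmetrize V : finite_dimensional V ->
  finite_dimensional (symmetrize V).
Proof.
move=> [d hd]; exists (d.+1 * d.+1)%N => s us [Vs [x sx]].
have [ab hab] : {ab : set X -> set X * set X & forall C, symmetrize V C ->
    [/\ V (ab C).1, V (ab C).2 & C = (ab C).1 `&` flip (ab C).2]}.
  apply: (@choice _ _ (fun C D => symmetrize V C ->
    [/\ V D.1, V D.2 & C = D.1 `&` flip D.2])) => C.
  have [[A [_ [VA [B VB <-] ->]]]|nV] := pselect (symmetrize V C); last by exists (C, C).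
  by exists (A, B).
have bound (f : set X -> set X) y : (forall C, C \in s -> V (f C) /\ f C y) ->
    (size (undup (map f s)) <= d.+1)%N.
  move=> hf; apply: hd; first exact: undup_uniq.
  split=> [A|]; last exists y => A; rewrite mem_undup => /mapP[C /hf[? ?] ->] //.
have b1 := bound (fun C => (ab C).1) x; have b2 := bound (fun C => (ab C).2) (T x).
have {}b1 : (size (undup [seq (ab C).1 | C <- s]) <= d.+1)%N.
  apply: b1 => C Cs; have [? _ e] := hab _ (Vs _ Cs); split => //.
  by have := sx _ Cs; rewrite {1}e => -[].
have {}b2 : (size (undup [seq (ab C).2 | C <- s]) <= d.+1)%N.
  apply: b2 => C Cs; have [_ ? e] := hab _ (Vs _ Cs); split => //.
  by have := sx _ Cs; rewrite {1}e => -[].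
apply: leq_trans (leqnSn _); rewrite -(size_map ab).
apply: leq_trans (leq_mul b1 b2); rewrite -(size_allpairs pair).
apply: uniq_leq_size.
  rewrite map_inj_in_uniq // => C D Cs Ds e.
  have [_ _ ->] := hab _ (Vs _ Cs); have [_ _ ->] := hab _ (Vs _ Ds).
  by rewrite e.
move=> _ /mapP[C Cs ->]; apply/allpairsP; exists (ab C).
rewrite !mem_undup (map_f (fun D => (ab D).1) Cs) (map_f (fun D => (ab D).2) Cs).
by split => //; case: (ab C).
Qed.

(** Choose an orbit among those that meet the tuple, depending only on the set
    of these orbits; the apex is the member of that orbit that occurs in the
    tuple, which is unique if the tuple never contains both A and flip A. *)
Lemma equivariant_apex : exists m : seq (set X) -> set X,
  [/\ forall s, s != [::] -> m s \in s,
      forall s s', perm_eq s s' -> m s = m s' &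
      forall s, s != [::] -> (forall A, A \in s -> flip A \notin s) ->
        m (map flip s) = flip (m s)].
Proof.
have [rho hrho] := orbit_representative flipK.
pose mu s := xget setT [set B | B \in map rho s].
exists (fun s => if mu s \in s then mu s else flip (mu s)).
have muP s : s != [::] -> mu s \in s \/ flip (mu s) \in s.
  move=> s0; have : mu s \in map rho s.
    apply: (@xgetPex _ setT [set B | B \in map rho s]).
    by case: s s0 => // A s _; exists (rho A); rewrite /= inE eqxx.
  move=> /mapP[A As e]; have [_ [eA|eA]] := hrho A; first by left; rewrite e eA.
  by right; rewrite e eA flipK.
have muflip s : mu (map flip s) = mu s.
  rewrite /mu -map_comp (@eq_map _ _ (rho \o flip) rho) // => A /=.
  by have [] := hrho A.
split=> [s s0|s s' ss'|s s0 free].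
- by have [ms|/negP nms] := boolP (mu s \in s); last by case: (muP s s0).
- have -> : mu s = mu s'.
    rewrite /mu; congr xget; apply/seteqP; split => B /=;
    by rewrite (perm_mem (perm_map rho ss')).
  by rewrite (perm_mem ss').
rewrite muflip.
have memflip A : (A \in map flip s) = (flip A \in s).
  by rewrite -{1}(flipK A) mem_map //; exact: flip_inj.
rewrite memflip; case: (boolP (mu s \in s)) => [ms|nms].
  by rewrite (negbTE (free _ ms)).
by rewrite flipK; case: (muP s s0) => [/(negP nms)//|->].
Qed.

(** For k greater than the dimension every k-simplex has a repetition, so
    reduce kills w^k and the homotopy reduce_htp exhibits it as a coboundary. *)
Lemma wpow_trivial_large : finitistic X ->
  exists N, forall k, (N < k)%N -> wpow_trivial k.
Proof.
move=> [hX _ hfin]; have [V [oV rV dV]] := hfin _ (free_open_cover hX).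
have fW : free_cover (symmetrize V).
  by apply: symmetrize_free_cover rV _ => // A x [_ fA]; exact: fA.
have [N hN] := finite_dimensional_symmetrize dV.
set W := symmetrize V in fW hN; have [oW tW frW] := fW.
have [eps heps] := odd_sign_exists flipK.
have he : odd_sign W eps by move=> A WA A0; apply/heps/(flip_neq fW WA A0).
have [m [m_mem m_perm m_flip]] := equivariant_apex.
exists N => k Nk; exists W, eps, (reduce_htp m (wpow eps)); split => //.
  move=> s ws; rewrite (reduce_htp_map flip_inj) => [|t t0 ts].
    apply: (eq_reduce_htp_in m_mem) => u us _; apply: wpow_flip_nerve he _.
    exact: in_nerve_sub us ws.
  apply: m_flip => // A /ts As; apply/negP => /ts fAs.
  by have [Ws [x sx]] := ws; apply: (frW _ x (Ws _ As) (sx _ As)); exact: (sx _ fAs).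
move=> s [ss ns].
have := reduce_htpP m_perm (wpow eps) s.
rewrite reduce_nuniq ?addbF => [<-|]; last first.
  by apply/negP => us; have := hN _ us ns; rewrite ss; lia.
rewrite [reduce_htp _ _ _](_ : _ = false) ?addbF //.
rewrite -(reduce_htp0 m s); apply: (eq_reduce_htp_in m_mem) => u _ su.
by apply: wpow_cocycle; rewrite su ss.
Qed.

Lemma wpow_trivial_above d : finitistic X ->
  (forall p, (d < p)%N -> forall x : cechH X p, x = 0%R) ->
  wpow_trivial d.+1.
Proof.
move=> fX h; have [N hN] := wpow_trivial_large fX.
have down j : wpow_trivial (d.+1 + j) -> wpow_trivial d.+1.
  elim: j => [|j IH]; first by rewrite addn0.
  rewrite addnS => hj; apply: IH; rewrite addSn; apply: wpow_descent => //;
  by apply: h; lia.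
by apply: (down N); apply: hN; lia.
Qed.

End FreeInvolution.

(** * Chains subdividing the hemispheres *)

Section Chains.
Variables (P : Type).
Implicit Types (E : (seq P -> bool) -> bool) (f g : seq P -> bool)
  (Q : seq P -> Prop).

(** A mod 2 chain is represented by the functional of evaluating cochains on
    it: E (delta f) is then the value of f on the boundary of E.  The tuples
    that occur in it are recorded by the predicate supported. *)
Definition additive_chain E :=
  forall f g, E (fun s => f s (+) g s) = E f (+) E g.

Definition supported E Q :=
  forall f g, (forall s, Q s -> f s = g s) -> E f = E g.

Lemma additive_chain0 E : additive_chain E -> E (fun=> false) = false.
Proof. by move=> aE; have := aE (fun=> false) (fun=> false); rewrite /= addbb. Qed.

Lemma supported_sub E Q Q' : (forall s, Q s -> Q' s) ->
  supported E Q -> supported E Q'.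
Proof. by move=> QQ h f g fg; apply: h => s /QQ/fg. Qed.

Lemma telescope_addb (u : nat -> bool) N :
  \big[addb/false]_(j < N) (u j (+) u j.+1) = u 0 (+) u N.
Proof.
elim: N => [|N IH]; first by rewrite big_ord0 addbb.
by rewrite big_ord_recr /= IH -addbA addKb.
Qed.

End Chains.

Section EuclideanChains.
Variables (R : realType) (m : nat).
Local Notation P := 'rV[R]_m.+1.
Implicit Types (x y : P) (s : seq P) (d : R) (k : nat).

Definition sqnorm x : R := \sum_i x ord0 i ^+ 2.

(** The distances are those of the maximum norm. *)
Definition mesh_le d s := forall x y, x \in s -> y \in s ->
  forall i, `|x ord0 i - y ord0 i| <= d.

Definition tuples_in (K : set P) l d s :=
  [/\ size s = l, forall x, x \in s -> K x & mesh_le d s].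

Section Cone.
Variable K : set P.
Hypothesis K_star : forall (t : R) x, 0 <= t <= 1 -> K x -> K (t *: x).
Hypothesis K_bound : forall x i, K x -> `|x ord0 i| <= 1.

Lemma mesh_scale d (t t' e : R) x y i :
  0 <= t <= 1 -> `|t - t'| <= e -> K x -> K y ->
  `|x ord0 i - y ord0 i| <= d ->
  `|(t *: x) ord0 i - (t' *: y) ord0 i| <= d + e.
Proof.
move=> /andP[t0 t1] te Kx Ky xy; rewrite !mxE.
have -> : t * x ord0 i - t' * y ord0 i =
  t * (x ord0 i - y ord0 i) + (t - t') * y ord0 i by ring.
apply: le_trans (ler_normD _ _) _; apply: lerD; rewrite normrM.
  rewrite (ger0_norm t0); apply: le_trans xy.
  by rewrite ler_piMl.
by apply: le_trans te; rewrite ler_piMr //; exact: K_bound.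
Qed.

(** A cycle E in a set that is star-shaped at the origin is filled by the trace
    of its radial contraction, performed in N steps so that the simplices remain
    small: the prisms between consecutive homothetic copies of E, and the cone
    over the last copy, which is concentrated at the origin. *)
Lemma cone_filling (E : (seq P -> bool) -> bool) l d (N : nat) :
  additive_chain E -> supported E (tuples_in K l.+1 d) -> (0 < N)%N ->
  (forall f, E (delta f) = false) ->
  exists F, [/\ additive_chain F,
    supported F (tuples_in K l.+2 (d + N%:R^-1)) & forall f, F (delta f) = E f].
Proof.
move=> aE sE N0 cE.
have N0' : 0 < N%:R :> R by rewrite ltr0n.
pose h (j : nat) (x : P) := (j%:R / N%:R : R) *: x.
pose F (f : seq P -> bool) :=
  \big[addb/false]_(j < N) E (mod2_prism (h j) (h j.+1) f) (+)
  E (fun s => f (h 0 (0 : P) :: map (h 0) s)).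
have t01 j : (j <= N)%N -> 0 <= (j%:R / N%:R : R) <= 1.
  move=> jN; rewrite divr_ge0 ?ler0n //= ler_pdivrMr // mul1r ler_nat.
  exact: jN.
have hK j x : (j <= N)%N -> K x -> K (h j x) by move=> /t01; exact: K_star.
have d_ge0 s : tuples_in K l.+1 d s -> 0 <= d.
  case: s => [[]//|x s [_ _ c]].
  by apply: le_trans (c x x _ _ ord0); rewrite ?normr_ge0 ?inE ?eqxx.
exists F; split=> [f g|f g fg|f].
- rewrite /F (aE (fun s => f _)) addbACA; congr (_ (+) _).
  rewrite -big_split /=; apply: eq_bigr => j _; rewrite -aE; congr E.
  by apply/funext => s; rewrite mod2_prismD.
- rewrite /F; congr (_ (+) _); last first.
    apply: sE => s ts; apply: fg; have [ss sK sc] := ts; split.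
    + by rewrite /= size_map ss.
    + move=> x; rewrite inE => /orP[/eqP ->|/mapP[y ys ->]]; last exact/hK/sK.
      case: s ss sK {ts sc} => // z s _ sK.
      have -> : h 0 (0 : P) = h 0 z by rewrite /h mul0r !scale0r.
      by apply/hK/sK => //; rewrite inE eqxx.
    + have z x : x \in h 0 (0 : P) :: map (h 0) s -> x = 0.
        rewrite inE => /orP[/eqP ->|/mapP[y _ ->]]; first by rewrite /h scaler0.
        by rewrite /h mul0r scale0r.
      move=> x y /z -> /z -> i; rewrite subrr normr0 addr_ge0 ?invr_ge0 ?ler0n //.
      exact: d_ge0 ts.
  apply: eq_bigr => j _; apply: sE => s ts; apply: eq_mod2_prism_in => u us su.
  have [ss sK sc] := ts; apply: fg.
  have uP x : x \in u -> exists j' y,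
      [/\ (j' <= N)%N, (j <= j' <= j.+1)%N, y \in s & x = h j' y].
    move=> /us; rewrite mem_cat => /orP[] /mapP[y ys ->].
      by exists j, y; split => //; [apply/ltnW/ltn_ord|rewrite leqnn leqnSn].
    by exists j.+1, y; split => //; rewrite leqnn leqnSn.
  split; first by rewrite su ss.
    by move=> x /uP[j' [y [jN _ ys ->]]]; apply/hK/sK.
  move=> x y /uP[a [x' [aN aj xs ->]]] /uP[b [y' [bN bj ys ->]]] i.
  apply: mesh_scale; [exact: t01| |exact: sK|exact: sK|exact: sc].
  rewrite -mulrBl normrM (@ger0_norm _ N%:R^-1) ?invr_ge0 ?ler0n //.
  rewrite ler_piMl ?invr_ge0 ?ler0n //.
  have [ab|/ltnW ba] := leqP a b.
    by rewrite distrC -natrB // normr_nat (ler_nat _ _ 1); lia.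
  by rewrite -natrB // normr_nat (ler_nat _ _ 1); lia.
pose u j := E (fun s => f (map (h j) s)).
have cone : E (fun s => delta f (h 0 (0 : P) :: map (h 0) s)) = u 0%N.
  rewrite /= aE.
  have -> : (fun s => delta (fun t => f (h 0 (0 : P) :: t)) (map (h 0) s)) =
      delta (fun s => f (h 0 (0 : P) :: map (h 0) s)).
    by apply/funext => s; rewrite (delta_map (h 0) (fun t => f (h 0 (0 : P) :: t))).
  by rewrite cE addbF.
have pr j : E (mod2_prism (h j) (h j.+1) (delta f)) = u j (+) u j.+1.
  rewrite -(aE (fun s => f (map (h j) s))).
  rewrite -[RHS]addbF -(cE (mod2_prism (h j) (h j.+1) f)) -aE; congr E.
  apply/funext => s; exact: mod2_prism_delta.
rewrite /F cone (eq_bigr (fun j : 'I_N => u j (+) u j.+1)) => [|j _]; last exact: pr.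
rewrite telescope_addb addbC addKb /u; congr E; apply/funext => s.
by rewrite -[in RHS](map_id s); congr f; apply: eq_map => x;
   rewrite /h divff ?scale1r ?gt_eqF.
Qed.

End Cone.

End EuclideanChains.

Section Hemispheres.
Variables (R : realType) (m : nat).
Local Notation P := 'rV[R]_m.+1.
Implicit Types (x y : P) (s : seq P) (d : R) (k : nat).

(** For k <= m, disc k has dimension k and subsphere k bounds disc k.+1. *)
Definition disc k : set P :=
  [set x | sqnorm x <= 1 /\ forall i : 'I_m.+1, (k <= i)%N -> x ord0 i = 0].
Definition subsphere k : set P :=
  [set x | sqnorm x = 1 /\ forall i : 'I_m.+1, (k < i)%N -> x ord0 i = 0].

Lemma subsphere_disc k x : subsphere k x -> disc k.+1 x.
Proof. by move=> [x1 x0]; split; rewrite ?x1. Qed.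

Lemma sqnormZ (t : R) x : sqnorm (t *: x) = t ^+ 2 * sqnorm x.
Proof. by rewrite /sqnorm mulr_sumr; apply: eq_bigr => i _; rewrite mxE exprMn. Qed.

Lemma sqnormN x : sqnorm (- x) = sqnorm x.
Proof. by rewrite -scaleN1r sqnormZ sqrrN expr1n mul1r. Qed.

Lemma disc_star k (t : R) x : 0 <= t <= 1 -> disc k x -> disc k (t *: x).
Proof.
move=> /andP[t0 t1] [x1 x0]; split=> [|i ki]; last by rewrite mxE x0 ?mulr0.
rewrite sqnormZ; apply: le_trans x1; rewrite ler_piMl ?exprn_ile1 //.
by apply: sumr_ge0 => i _; exact: sqr_ge0.
Qed.

Lemma disc_bound k x i : disc k x -> `|x ord0 i| <= 1.
Proof.
move=> [x1 _]; rewrite -(@expr_le1 _ 2) // real_normK ?num_real //.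
apply: le_trans x1; rewrite /sqnorm (bigD1 i) //= lerDl.
by apply: sumr_ge0 => j _; exact: sqr_ge0.
Qed.

(** The inverse of the orthogonal projection of the upper hemisphere of
    subsphere k onto disc k. *)
Definition lift_point k x : P :=
  x + Num.sqrt (1 - sqnorm x) *: delta_mx ord0 (inord k).

Lemma lift_point_id k x : sqnorm x = 1 -> lift_point k x = x.
Proof. by move=> x1; rewrite /lift_point x1 subrr sqrtr0 scale0r addr0. Qed.

Lemma lift_pointE k x (i : 'I_m.+1) : (k <= m)%N -> disc k x ->
  lift_point k x ord0 i =
  if i == k :> nat then Num.sqrt (1 - sqnorm x) else x ord0 i.
Proof.
move=> km [x1 x0]; rewrite !mxE /= ?eqxx /=.
have -> : (i == inord k) = (i == k :> nat) by rewrite -val_eqE /= inordK.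
case: eqP => [ik|_]; last by rewrite mulr0 addr0.
by rewrite x0 ?ik // add0r mulr1.
Qed.

Lemma lift_point_subsphere k x : (k <= m)%N -> disc k x ->
  subsphere k (lift_point k x).
Proof.
move=> km dx; have [x1 x0] := dx; split=> [|i ki]; last first.
  by rewrite lift_pointE // gtn_eqF // x0 // ltnW.
have ik : (inord k : 'I_m.+1) = k :> nat by rewrite inordK.
rewrite /sqnorm (bigD1 (inord k)) //= lift_pointE // ik eqxx sqr_sqrtr ?subr_ge0 //.
rewrite {1}/sqnorm (bigD1 (inord k)) //= x0 ?ik // expr0n /= add0r.
rewrite [X in _ + X](eq_bigr (fun i => x ord0 i ^+ 2)) ?subrK // => i ni.
by rewrite lift_pointE // -ik val_eqE (negbTE ni).
Qed.

Lemma sqrt_dist (u v : R) : 0 <= u -> 0 <= v ->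
  `|Num.sqrt u - Num.sqrt v| <= Num.sqrt `|u - v|.
Proof.
wlog uv : u v / v <= u.
  move=> h u0 v0; have [vu|/ltW uv] := leP v u; first exact: h.
  by rewrite distrC (distrC u); exact: h.
move=> u0 v0; rewrite ger0_norm ?subr_ge0 ?ler_sqrt // ger0_norm ?subr_ge0 //.
rewrite lerBlDr -(@ler_sqr _ (Num.sqrt u)) ?nnegrE ?addr_ge0 ?sqrtr_ge0 //.
rewrite sqrrD !sqr_sqrtr ?subr_ge0 // addrAC subrK lerDl.
by rewrite mulrn_wge0 // mulr_ge0 ?sqrtr_ge0.
Qed.

Lemma sqnorm_dist k x y d : disc k x -> disc k y ->
  (forall i, `|x ord0 i - y ord0 i| <= d) ->
  `|sqnorm y - sqnorm x| <= (m.+1).*2%:R * d.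
Proof.
move=> dx dy xy; rewrite /sqnorm -sumrB; apply: le_trans (ler_norm_sum _ _ _) _.
apply: (@le_trans _ _ (\sum_(i < m.+1) (2 * d))).
  apply: ler_sum => i _; rewrite subr_sqr normrM mulrC distrC.
  apply: ler_pM => //; apply: le_trans (ler_normD _ _) _.
  by rewrite -[2]/(1 + 1); apply: lerD; [exact: disc_bound dy|exact: disc_bound dx].
by rewrite sumr_const card_ord -[leLHS]mulr_natl mulrA -natrM muln2.
Qed.

(** Uniform continuity of the lift, explicitly: the squared norms of two points
    of the disc at distance at most e differ by at most 2 (m + 1) e, and the
    square root is 1/2-Hoelder with constant 1. *)
Lemma mesh_lift k d e s : (k <= m)%N -> e <= d -> 0 <= d ->
  (m.+1).*2%:R * e <= d ^+ 2 ->
  (forall x, x \in s -> disc k x) -> mesh_le e s -> mesh_le d (map (lift_point k) s).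
Proof.
move=> km ed d0 ed2 ds cs _ _ /mapP[x xs ->] /mapP[y ys ->] i.
have dx := ds _ xs; have dy := ds _ ys; have [x1 _] := dx; have [y1 _] := dy.
rewrite !lift_pointE //; case: eqP => _; last exact: le_trans (cs _ _ xs ys i) ed.
apply: le_trans (sqrt_dist _ _) _; rewrite ?subr_ge0 //.
rewrite -(ger0_norm d0) -(sqrtr_sqr d) ler_wsqrtr //; apply: le_trans ed2.
have -> : 1 - sqnorm x - (1 - sqnorm y) = sqnorm y - sqnorm x by ring.
by apply: (sqnorm_dist dx dy) => j; exact: cs.
Qed.

Definition chain_step (E E' : (seq P -> bool) -> bool) :=
  forall f, E' (delta f) = E f (+) E (fun s => f (map -%R s)).

Lemma subsphereN k x : subsphere k x -> subsphere k (- x).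
Proof.
move=> [x1 x0]; split; first by rewrite sqnormN.
by move=> i /x0 xi; rewrite mxE xi oppr0.
Qed.

Lemma tuplesN k l d s : tuples_in (subsphere k) l d s ->
  tuples_in (subsphere k) l d (map -%R s).
Proof.
move=> [ss sS sc]; split; first by rewrite size_map.
  by move=> _ /mapP[x xs ->]; apply/subsphereN/sS.
move=> _ _ /mapP[x xs ->] /mapP[y ys ->] i.
by rewrite !mxE -opprD normrN; exact: sc.
Qed.

(** E_k plus its antipode is a cycle on the sphere of dimension k.  This sphere
    bounds a disc, in which the cycle is filled by contraction, and the filling
    is lifted to the upper hemisphere of dimension k + 1; the lift fixes the
    points of the bounding sphere.  The mesh required of E_k is dictated by
    the modulus of continuity of the lift. *)
Lemma hemisphere_chains k d : (k <= m)%N -> 0 < d ->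
  exists E : nat -> (seq P -> bool) -> bool,
    [/\ forall j, (j <= k)%N -> additive_chain (E j) /\
          supported (E j) (tuples_in (subsphere j) j.+1 d),
        E 0%N = fun f => f [:: delta_mx ord0 ord0] &
        forall j, (j < k)%N -> chain_step (E j) (E j.+1)].
Proof.
elim: k d => [|k IH] d km d0.
  exists (fun _ f => f [:: delta_mx ord0 ord0]); split => // -[] // _; split=> // f g.
  apply; split=> // [x|x y]; rewrite !inE => /eqP ->; last first.
    by move=> /eqP -> i; rewrite subrr normr0 ltW.
  split=> [|i i0]; last by rewrite mxE eqxx /= -val_eqE /= gtn_eqF.
  rewrite /sqnorm (bigD1 ord0) //= big1 ?mxE ?eqxx ?expr1n ?addr0 // => i i0.
  by rewrite mxE eqxx /= (negbTE i0) expr0n.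
(* The filling has mesh at most e / 2 + 1 / N <= e, and the lift turns mesh e
   into mesh d. *)
pose e := Num.min d (d ^+ 2 / (m.+1).*2%:R).
have m0 : 0 < (m.+1).*2%:R :> R by rewrite ltr0n.
have e0 : 0 < e by rewrite lt_min d0 /= divr_gt0 // exprn_gt0.
have ed : e <= d by rewrite ge_min lexx.
have ed2 : (m.+1).*2%:R * e <= d ^+ 2.
  by rewrite mulrC -ler_pdivlMr // ge_min lexx orbT.
have [N N0 Ne] : exists2 N : nat, (0 < N)%N & N%:R^-1 <= e / 2.
  have := @archi_boundP R (e / 2)^-1; set N := Num.bound _ => h.
  have {}h : (e / 2)^-1 < N%:R by apply: h; rewrite invr_ge0 ltW // divr_gt0.
  have N0 : 0 < N%:R :> R by apply: lt_trans h; rewrite invr_gt0 divr_gt0.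
  exists N; first by rewrite ltr0n in N0.
  by rewrite -[leRHS]invrK lef_pV2 ?posrE ?invr_gt0 ?divr_gt0 // ltW.
have e20 : 0 < e / 2 by rewrite divr_gt0.
have [E [E1 E2 E3]] := IH (e / 2) (ltnW km) e20.
have [aE sE] := E1 k (leqnn k).
pose C f := E k f (+) E k (fun s => f (map -%R s)).
have mapNK s : map -%R (map -%R s) = s.
  by rewrite -map_comp -[RHS]map_id; apply: eq_map => x; rewrite /= opprK.
have aC : additive_chain C.
  by move=> f g; rewrite /C aE (aE (fun s => f _)) addbACA.
have sC : supported C (tuples_in (disc k.+1) k.+1 (e / 2)).
  have sub s : tuples_in (subsphere k) k.+1 (e / 2) s ->
      tuples_in (disc k.+1) k.+1 (e / 2) s.
    by move=> [? h ?]; split => // x /h; exact: subsphere_disc.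
  move=> f g fg; congr (_ (+) _); apply: sE => s ts; apply: fg; apply: sub => //.
  exact: tuplesN.
have cC f : C (delta f) = false.
  rewrite /C; have -> : (fun s => delta f (map -%R s)) =
      delta (fun s => f (map -%R s)).
    by apply/funext => s; rewrite delta_map.
  case: (k) E2 E3 => [|k'] E2 E3; first by rewrite E2 /= !addbF addbb.
  rewrite !E3 //; under [X in _ (+) (_ (+) E k' X)]funext do rewrite mapNK.
  by rewrite [X in _ (+) X]addbC addbb.
have [F [aF sF FC]] := cone_filling (@disc_star k.+1) (@disc_bound k.+1) aC sC N0 cC.
pose F' f := F (fun s => f (map (lift_point k.+1) s)).
exists (fun j => if j == k.+1 then F' else E j); split=> [j|//|j].
- rewrite leq_eqVlt; case: eqP => [->|_] /= jk; last first.
    have [aj sj] := E1 j jk; split => //; apply: supported_sub sj => s [? ? c].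
    split => // x y xs ys i; apply: le_trans (c x y xs ys i) _.
    by apply: le_trans ed; rewrite ler_piMr ?invf_le1 ?ler1n // ltW.
  split=> [f g|f g fg]; first exact: aF.
  apply: sF => s [ss sD sc]; apply: fg; split; first by rewrite size_map.
    by move=> _ /mapP[x xs ->]; apply/lift_point_subsphere/sD.
  apply: (@mesh_lift _ d e) => //; first exact: ltW.
  move=> x y xs ys i; apply: le_trans (sc x y xs ys i) _.
  by rewrite [leRHS](splitr e) lerD2l.
rewrite ltnS leq_eqVlt eqSS; case: eqP => [-> _|nj /= jk]; last first.
  by rewrite ltn_eqF ?(leqW jk) //; exact: E3.
rewrite ltn_eqF // => f.
rewrite /F'; have -> : (fun s => delta f (map (lift_point k.+1) s)) =
    delta (fun s => f (map (lift_point k.+1) s)).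
  by apply/funext => s; rewrite delta_map.
rewrite FC.
have lid s : tuples_in (subsphere k) k.+1 (e / 2) s -> map (lift_point k.+1) s = s.
  move=> [_ sS _]; rewrite -[RHS]map_id; apply/eq_in_map => x /sS[x1 _].
  exact: lift_point_id.
by congr (_ (+) _); apply: sE => s ts; rewrite lid //; exact: tuplesN.
Qed.

End Hemispheres.

(** * Equivariant maps from the sphere *)

Section SphereCoverings.
Variables (R : realType) (m : nat).
Local Notation P := 'rV[R]_m.+1.
Local Notation S := (@unit_sphere R m).

Definition sphere_point (x : P) (Sx : S x) : sphere R m :=
  exist (fun v => v \in S) x (mem_set Sx).

Lemma unit_sphere_compact : compact S.
Proof.
apply: bounded_closed_compact.
  exists 1; split=> [|M M1 x Sx]; first exact: num_real.
  apply: le_trans (ltW M1); rewrite [leLHS]/Num.norm /= mx_normrE.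
  apply/bigmax_leP; split => // -[i j] _ /=; rewrite ord1.
  apply: (@disc_bound _ _ m.+1); split=> [|k]; first by rewrite -[leRHS]Sx.
  by rewrite leqNgt ltn_ord.
have -> : S = @sqnorm R m @^-1` [set 1] by [].
apply: closed_comp; last exact: closed_eq.
move=> x _; rewrite /sqnorm; elim: (index_enum _) => [|i r IH].
  have -> : (fun x : P => \sum_(i <- [::]) x ord0 i ^+ 2) = cst 0.
    by apply/funext => y; rewrite big_nil.
  exact: cst_continuous.
have -> : (fun x : P => \sum_(j <- i :: r) x ord0 j ^+ 2) =
    (fun x : P => x ord0 i ^+ 2) \+ (fun x : P => \sum_(j <- r) x ord0 j ^+ 2).
  by apply/funext => y; rewrite big_cons.
by apply: continuousD => //; apply: continuousM; exact: coord_continuous.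
Qed.

(** A Lebesgue number for the covering of the sphere by the preimages of the
    members of W. *)
Lemma sphere_lebesgue (X : topologicalType) (phi : sphere R m -> X)
    (W : set (set X)) : continuous phi -> open_cover W ->
  exists2 d : R, 0 < d & forall x, S x -> exists A, W A /\
    forall y : sphere R m,
      (forall i, `|x ord0 i - set_val y ord0 i| <= d) -> A (phi y).
Proof.
move=> phic [oW cW].
pose Q (d : R) (x : P) := exists A, W A /\ forall y : sphere R m,
  (forall i, `|x ord0 i - set_val y ord0 i| <= d) -> A (phi y).
have cover x : S x -> \forall x' \near x & d \near at_right 0, Q d x'.
  move=> Sx.
  have [A WA Ax] : (\bigcup_(A in W) A) (phi (sphere_point Sx)) by rewrite cW.
  have [O oO OA] : open (phi @^-1` A).
    by move/continuousP: phic; apply; exact: oW.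
  have : nbhs x O.
    by apply: open_nbhs_nbhs; split => //;
       have : (set_val @^-1` O) (sphere_point Sx) by rewrite OA.
  move=> /nbhs_ballP[e /= e0 eO].
  exists (ball x (e / 2), [set d | d < e / 2]) => /=.
    split; first by apply: nbhsx_ballx; rewrite divr_gt0.
    by apply: nbhs_right_lt; rewrite divr_gt0.
  move=> [x' d] /= [xx' de]; exists A; split => // y yd.
  suff : (set_val @^-1` O) y by rewrite OA.
  apply: eO; split=> // i j; rewrite [i]ord1.
  have h1 : `|x ord0 j - x' ord0 j| < e / 2 := xx'.2 ord0 j.
  have h2 := yd j.
  rewrite /ball /= -(subrKA (x' ord0 j)); apply: le_lt_trans (ler_normD _ _) _.
  by rewrite (splitr e); apply: ltrD => //; exact: le_lt_trans de.
have near : \forall d \near at_right 0, S `<=` Q d.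
  by move/compact_near_coveringP: unit_sphere_compact; apply.
have [d [d0 hd]] : exists d, 0 < d /\ S `<=` Q d.
  by apply: (@filter_ex _ (at_right 0)); apply: filterI near; exact: nbhs_right_gt.
by exists d.
Qed.

End SphereCoverings.

Section NoEquivariantMap.
Variables (R : realType) (m : nat) (X : topologicalType) (T : X -> X).
Hypothesis TT : involutive T.
Local Notation P := 'rV[R]_m.+1.

(** Label each point x of the sphere by a member L x of W that contains the
    image of the ball of radius d at x, equivariantly.  A tuple of points of
    mesh at most d is then mapped by L to a simplex of the nerve of W, the
    image of its first point being common to all the labels.  So the chains E_j
    can be evaluated on w^j, which gives 1, and on d c = w^(k+1), which
    gives 0. *)
Lemma no_equivariant_map k (phi : sphere R m -> X) : (k < m)%N ->
  continuous phi ->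
  (forall y y' : sphere R m, set_val y' = - set_val y -> phi y' = T (phi y)) ->
  ~ wpow_trivial T k.+1.
Proof.
move=> km phic phiT [W [eps [c [fW he hc hdc]]]]; have [oW tW frW] := fW.
have [d d0 hd] := sphere_lebesgue phic oW.
have SN (x : P) : unit_sphere x -> unit_sphere (- x).
  by move=> Sx; rewrite /unit_sphere /= -[RHS]Sx; exact: sqnormN.
have oppK : involutive (-%R : P -> P) by exact: opprK.
pose near_in (x : P) (A : set X) := W A /\ forall y : sphere R m,
  (forall i, `|x ord0 i - set_val y ord0 i| <= d) -> A (phi y).
have near_inN x A : unit_sphere x -> near_in x A -> near_in (- x) (flip T A).
  move=> Sx [WA hA]; split=> [|y xy]; first exact: tW.
  have Sy : unit_sphere (- set_val y) by apply/SN/set_valP.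
  rewrite /flip /preimage /= -(phiT y (sphere_point Sy)) //; apply: hA => i.
  have -> : x ord0 i - set_val (sphere_point Sy) ord0 i =
      - ((- x) ord0 i - set_val y ord0 i) by rewrite /= !mxE; ring.
  by rewrite normrN.
have [L hL] := @equivariant_choice _ _ oppK _ setT _ (@unit_sphere R m)
  near_in (flipK TT) near_inN SN hd.
have LW (x : P) : unit_sphere x -> W (L x) by move=> /hL[[]].
have Lphi (x : P) (Sx : unit_sphere x) y : unit_sphere y ->
    (forall i, `|y ord0 i - x ord0 i| <= d) -> L y (phi (sphere_point Sx)).
  by move=> /hL[[_ h] _] xy; apply: h.
have LN (x : P) : unit_sphere x -> L (- x) = flip T (L x).
  move=> Sx; have [_ ->//] := hL _ Sx; move=> xN.
  have x0 : x = 0.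
    apply/rowP => i; have := congr1 (fun v : P => v ord0 i) xN; rewrite !mxE; lra.
  move: Sx; rewrite /unit_sphere /= big1; first by move/eqP; rewrite eq_sym oner_eq0.
  by move=> i _; rewrite x0 mxE expr0n.
have km' : (k.+1 <= m)%N by [].
have [E [Es E0 Estep]] := hemisphere_chains km' d0.
have nerve j s : tuples_in (@subsphere R m j) j.+1 d s ->
    simplex W j (map L s).
  move=> [ss sS sc]; split; first by rewrite size_map.
  split=> [_ /mapP[x /sS[x1 _] ->]|]; first exact: LW.
  case: s ss sS sc => // x s _ sS sc.
  have Sx : unit_sphere x by have [] := sS x (mem_head _ _).
  exists (phi (sphere_point Sx)) => _ /mapP[y ys ->]; apply: Lphi.
    by have [] := sS y ys.
  by move=> i; apply: sc => //; exact: mem_head.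
have mapLN j s : tuples_in (@subsphere R m j) j.+1 d s ->
    map L (map -%R s) = map (flip T) (map L s).
  move=> [_ sS _]; rewrite -!map_comp; apply/eq_in_map => x /sS[x1 _].
  exact: LN.
pose eps' x := eps (L x).
have eps'N j s x : tuples_in (@subsphere R m j) j.+1 d s -> x \in s ->
    eps' (- x) = ~~ eps' x.
  move=> ts xs; have [_ /(_ _ xs)[Sx _] _] := ts.
  rewrite /eps' LN //; apply: he; first exact: LW.
  by exists (phi (sphere_point Sx)); apply: Lphi => // i; rewrite subrr normr0 ltW.
have Ew j : (j <= k.+1)%N -> E j (wpow eps') = true.
  elim: j => [|j IH] jk; first by rewrite E0.
  have [_ sj1] := Es _ jk; have [aj sj] := Es _ (ltnW jk).
  pose ew s := if s is x :: _ then eps' x && wpow eps' s else false.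
  rewrite (sj1 _ (delta ew)); last by move=> s [ss _ _]; rewrite wpow_delta // ss.
  rewrite Estep // -aj -(IH (ltnW jk)); apply: sj => s ts.
  have := @wpow_flip _ eps' (fun x => eps' (- x)) s (fun x => @eps'N _ _ x ts).
  rewrite -wpow_map; case: s ts => [[]//|x s] ts; rewrite /ew /= => ->.
  rewrite (eps'N _ _ _ ts (mem_head _ _)).
  by case: (eps' x); rewrite /= ?addbF.
have [_ sE] := Es _ (leqnn k.+1); have [ak sk] := Es _ (leqnSn k).
have := Ew _ (leqnn _).
rewrite (sE _ (delta (fun s => c (map L s)))); last first.
  by move=> s /nerve ns; rewrite delta_map hdc // wpow_map.
rewrite Estep // -ak (sk _ (fun=> false)) ?additive_chain0 // => s ts.
by rewrite (mapLN _ _ ts) hc ?addbb //; have [] := nerve _ _ ts.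
Qed.

End NoEquivariantMap.

Theorem mainTheorem4 (R : realType) (X : topologicalType) (a b : int) (n : nat)
    (to : {action 'Z_2 &-> X}) :
  cohomology_type_in_degree X a b n ->
  (2 %| a)%Z -> (2 %| b)%Z ->
  continuous_action to -> free_action to ->
  forall m : nat, (3 * n < m)%N ->
    ~ exists phi : sphere R m -> X, equivariant_map (antipodal R m) to phi.
Proof.
move=> [fX n1 hX _] _ _ toc tof m nm [phi [phic phie]].
pose g : 'Z_2 := 1%R; pose T x := to x g.
have TT : involutive T.
  (* The identity acts idempotently and injectively, hence trivially. *)
  have [inj mor] : is_action [set: 'Z_2]%SET to by case: (to).
  have toM x u v : to (to x u) v = to x (u * v)%g by rewrite -mor // inE.
  by move=> x; rewrite /T toM; apply: (inj 1%g); rewrite toM; congr (to x _);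
     apply: val_inj.
have Tfree x : T x <> x.
  move=> Tx; have : isotropy to x g by [].
  by rewrite tof.
have hT : wpow_trivial T (3 * n).+1.
  apply: (wpow_trivial_above (toc g) TT Tfree fX) => p np.
  apply: hX; rewrite !inE; lia.
apply: (no_equivariant_map TT nm phic _ hT) => y y' yy'.
rewrite /T phie; congr phi; apply: val_inj.
by rewrite [LHS]yy' /= expr1 scaleN1r.
Qed.
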